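(* Let $Q$ and $Q'$ be two non-zero monomial irreducible ideals of $S=K[x_1,\ldots,x_n]$ with different associated prime ideals. Then $$\operatorname{sdepth}_S S/(Q\cap Q')= \max\left\{\min\left\{\dim(S/Q'),\left\lceil\frac{\dim(S/Q)+\dim(S/(Q+Q'))}{2}\right\rceil\right\},\ \min\left\{\dim(S/Q),\left\lceil\frac{\dim(S/Q')+\dim(S/(Q+Q'))}{2}\right\rceil\right\}\right\}.$$
   Context: $K$ is a field and $S=K[x_1,\ldots,x_n]$ with its standard $\mathbb{Z}^n$-grading (multigrading). A monomial ideal is irreducible if it is generated by powers of some of the variables. For a finitely generated multigraded $S$-module $M$, a homogeneous element $z\in M$ and $Z\subseteq\{x_1,\ldots,x_n\}$, let $zK[Z]\subset M$ be the $K$-subspace of all elements $zf$, $f\in K[Z]$; it is called a Stanley space of dimension $|Z|$ if it is a free $K[Z]$-module. A Stanley decomposition of $M$ is a presentation of the $K$-vector space $M$ as a finite direct sum of Stanley spaces $\mathcal{D}: M=\bigoplus_{i=1}^r z_iK[Z_i]$. Set $\operatorname{sdepth}\mathcal{D}=\min\{|Z_i|: i=1,\ldots,r\}$, and $\operatorname{sdepth}_S(M)=\operatorname{sdepth}(M)=\max\{\operatorname{sdepth}\mathcal{D}:\mathcal{D}\text{ a Stanley decomposition of }M\}$ (the Stanley depth of $M$). $\lceil a\rceil$ is the smallest integer $\geq a$.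
   Formalization: The formal theorem additionally assumes that neither of Q, Q' contains the other; without this the formula fails whenever one contains the other, e.g. Q=(x), Q'=(x,y) in K[x,y], where the Stanley depth is 1 but the formula gives 0. *)

(* Defs.v *)
From HB Require Import structures.
From mathcomp Require Import all_boot all_order all_algebra.
From mathcomp Require Import boolp classical_sets.
From mathcomp Require Import mpoly.

Set Implicit Arguments.
Unset Strict Implicit.
Unset Printing Implicit Defensive.

Import GRing.Theory.
Local Open Scope ring_scope.
Local Open Scope quotient_scope.

(* Unlike [idealr] of ring_quotient, ideals are allowed to be the whole ring,
   so that sums of ideals are ideals. *)
Record ideal (R : comPzRingType) := Ideal {
  ideal_mem :> {pred R};
  ideal0 : 0 \in ideal_mem;
  ideal_lin : forall a : R, {in ideal_mem &, forall u v, a * u + v \in ideal_mem}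
}.

Section Ideals.
Variable R : comPzRingType.
Implicit Types I J : ideal R.

Lemma idealMl I (a u : R) : u \in I -> a * u \in I.
Proof. by move=> uI; rewrite -[a * u]addr0 ideal_lin ?ideal0. Qed.

Lemma ideal_zmod_closed I : zmod_closed I.
Proof.
split=> [|x y xI yI]; first exact: ideal0.
by rewrite addrC -mulN1r ideal_lin.
Qed.

HB.instance Definition _ I :=
  GRing.isZmodClosed.Build R (ideal_mem I) (ideal_zmod_closed I).

Lemma idealI_lin I J (a : R) :
  {in [predI I & J] &, forall u v, a * u + v \in [predI I & J]}.
Proof.
by move=> u v /andP[uI uJ] /andP[vI vJ]; apply/andP; split; exact: ideal_lin.
Qed.

Lemma idealI0 I J : 0 \in [predI I & J].
Proof. by apply/andP; split; exact: ideal0. Qed.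

Definition idealI I J : ideal R := Ideal (idealI0 I J) (@idealI_lin I J).

Definition idealD_mem I J : {pred R} :=
  fun h => `[< exists2 f, f \in I & exists2 g, g \in J & h = f + g >].

Lemma idealD0 I J : 0 \in idealD_mem I J.
Proof.
by apply/asboolP; exists 0; [|exists 0; rewrite ?addr0]; rewrite ?ideal0.
Qed.

Lemma idealD_lin I J (a : R) :
  {in idealD_mem I J &, forall u v, a * u + v \in idealD_mem I J}.
Proof.
move=> u v /asboolP[f fI [g gJ ->]] /asboolP[f' fI' [g' gJ' ->]].
apply/asboolP; exists (a * f + f'); first exact: ideal_lin.
by exists (a * g + g'); rewrite ?ideal_lin // mulrDr addrACA.
Qed.

Definition idealD I J : ideal R := Ideal (idealD0 I J) (@idealD_lin I J).

Definition generates (G : R -> Prop) I : Prop :=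
  (forall g, G g -> g \in I) /\
  (forall J, (forall g, G g -> g \in J) -> {subset I <= J}).

Definition nonzero_ideal I : Prop := exists2 f, f \in I & f != 0.

Definition prime_ideal I : Prop :=
  1 \notin I /\ (forall a b, a * b \in I -> a \in I \/ b \in I).

Definition quot_ring I : Type := Quotient.quot (ideal_mem I).

End Ideals.

Section QuotientRing.
Variables (R : comPzRingType) (I : ideal R).
Local Notation Q := (quot_ring I).

HB.instance Definition _ := GRing.Zmodule.on Q.
HB.instance Definition _ :=
  ZmodQuotient.on (Quotient.quot (ideal_mem I)).

Definition quot_pi (x : R) : Q := \pi_(Quotient.quot (ideal_mem I)) x.
Definition quot_repr (x : Q) : R := repr (x : Quotient.quot (ideal_mem I)).

Lemma quot_reprK : cancel quot_repr quot_pi.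
Proof. exact: reprK. Qed.

Lemma quot_piP (x y : R) : quot_pi x = quot_pi y <-> x - y \in I.
Proof.
by rewrite -/(Quotient.equiv _ x y); split=> [/eqP|h]; [|apply/eqP]; rewrite piE.
Qed.

Lemma quot_piD (x y : R) : quot_pi (x + y) = quot_pi x + quot_pi y.
Proof. exact: (raddfD (\pi_(Quotient.quot (ideal_mem I)))). Qed.

Definition quot_one : Q := quot_pi 1.
Definition quot_mul (x y : Q) : Q := quot_pi (quot_repr x * quot_repr y).

Lemma quot_piM (x y : R) : quot_pi (x * y) = quot_mul (quot_pi x) (quot_pi y).
Proof.
apply/quot_piP; set x' := quot_repr _; set y' := quot_repr _.
have xI : x - x' \in I by apply/quot_piP; rewrite quot_reprK.
have yI : y - y' \in I by apply/quot_piP; rewrite quot_reprK.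
have -> : x * y - x' * y' = y * (x - x') + x' * (y - y').
  by rewrite !mulrBr [y * x]mulrC [y * x']mulrC addrA subrK.
by apply: ideal_lin => //; exact: idealMl.
Qed.

Lemma quot_mulA : associative quot_mul.
Proof.
move=> x y z; rewrite -[x]quot_reprK -[y]quot_reprK -[z]quot_reprK.
by rewrite -!quot_piM mulrA.
Qed.

Lemma quot_mulC : commutative quot_mul.
Proof. by move=> x y; rewrite /quot_mul mulrC. Qed.

Lemma quot_mul1 : left_id quot_one quot_mul.
Proof. by move=> x; rewrite -[x]quot_reprK -quot_piM mul1r. Qed.

Lemma quot_mulDl : left_distributive quot_mul +%R.
Proof.
move=> x y z; rewrite -[x]quot_reprK -[y]quot_reprK -[z]quot_reprK.
by rewrite -quot_piD -!quot_piM mulrDl quot_piD.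
Qed.

HB.instance Definition _ := GRing.Zmodule_isComPzRing.Build Q
  quot_mulA quot_mulC quot_mul1 quot_mulDl.

Definition quot_scale (a : R) (x : Q) : Q := quot_pi a * x.

Lemma quot_scaleA a b x :
  quot_scale a (quot_scale b x) = quot_scale (a * b) x.
Proof. by rewrite /quot_scale mulrA quot_piM. Qed.

Lemma quot_scale1 : left_id 1 quot_scale.
Proof. by move=> x; exact: mul1r. Qed.

Lemma quot_scaleDr : right_distributive quot_scale +%R.
Proof. by move=> a x y; exact: mulrDr. Qed.

Lemma quot_scaleDl x : {morph quot_scale^~ x : a b / a + b}.
Proof. by move=> a b; rewrite /quot_scale quot_piD mulrDl. Qed.

HB.instance Definition _ := GRing.Zmodule_isLmodule.Build R Q
  quot_scaleA quot_scale1 quot_scaleDr quot_scaleDl.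

End QuotientRing.

(* The maximum of a set of natural numbers; 0 if there is none. *)
Definition greatest (E : nat -> Prop) : nat :=
  xget 0%N [set d | E d /\ forall e, E e -> (e <= d)%N].

(* P 0 < P 1 < ... < P d *)
Definition prime_chain (R : comPzRingType) (d : nat) (P : nat -> ideal R) : Prop :=
  (forall i, (i <= d)%N -> prime_ideal (P i)) /\
  (forall i, (i < d)%N ->
     {subset P i <= P i.+1} /\ ~ {subset P i.+1 <= P i}).

Definition krull_dim (R : comPzRingType) : nat :=
  greatest (fun d => exists P : nat -> ideal R, prime_chain d P).

Definition associated_prime (R : comPzRingType) (M : lmodType R) (P : ideal R) : Prop :=
  prime_ideal P /\ exists z : M, forall a : R, a \in P <-> a *: z = 0.

Section Stanley.
Variables (K : fieldType) (n : nat).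
Local Notation S := {mpoly K[n]}.

(* The exponents a i are positive, so the ideal is proper; the zero ideal
   (A = set0) is included. *)
Definition irreducible_monomial (Q : ideal S) : Prop :=
  exists (A : {set 'I_n}) (a : 'I_n -> nat),
    (forall i, i \in A -> (0 < a i)%N) /\
    generates (fun g => exists2 i, i \in A & g = 'X_i ^+ a i) Q.

(* The component of S of multidegree a. *)
Definition mpoly_component (a : 'I_n -> int) (f : S) : Prop :=
  forall m, m \in msupp f -> forall i, (m i)%:Z = a i.

(* The induced Z^n-grading of S/I, for I a monomial ideal. *)
Definition quot_component (I : ideal S) (a : 'I_n -> int) (z : quot_ring I) : Prop :=
  exists2 f, mpoly_component a f & z = quot_pi I f.

(* The subring K[Z] of S. *)
Definition subpoly (Z : {set 'I_n}) (f : S) : Prop :=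
  forall m, m \in msupp f -> forall i, i \notin Z -> m i = 0%N.

(* comp a is the component of M of multidegree a. *)
Variables (M : lmodType S) (comp : ('I_n -> int) -> M -> Prop).

Definition homogeneous (z : M) : Prop := exists a, comp a z.

(* z K[Z] *)
Definition cyclic_space (z : M) (Z : {set 'I_n}) (x : M) : Prop :=
  exists2 f, subpoly Z f & x = f *: z.

(* N is a free K[Z]-module of finite rank. *)
Definition free_over (Z : {set 'I_n}) (N : M -> Prop) : Prop :=
  exists (k : nat) (b : 'I_k -> M),
    (forall x, N x <-> exists2 c : 'I_k -> S,
       (forall j, subpoly Z (c j)) & x = \sum_j c j *: b j) /\
    (forall c : 'I_k -> S, (forall j, subpoly Z (c j)) ->
       \sum_j c j *: b j = 0 -> forall j, c j = 0).

(* z != 0 discards the zero module, which is free of rank 0. *)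
Definition stanley_space (z : M) (Z : {set 'I_n}) : Prop :=
  [/\ homogeneous z, z != 0 & free_over Z (cyclic_space z Z)].

Definition stanley_decomposition (r : nat) (z : 'I_r -> M) (Z : 'I_r -> {set 'I_n}) : Prop :=
  (forall i, stanley_space (z i) (Z i)) /\
  (forall x : M, exists! y : {ffun 'I_r -> M},
     (forall i, cyclic_space (z i) (Z i) (y i)) /\ x = \sum_i y i).

(* Every #|Z i| is at most n, so n is neutral for the minimum. *)
Definition decomposition_sdepth (r : nat) (Z : 'I_r -> {set 'I_n}) : nat :=
  \big[minn/n]_(i < r) #|Z i|.

Definition sdepth : nat :=
  greatest (fun d => exists (r : nat) (z : 'I_r -> M) (Z : 'I_r -> {set 'I_n}),
    stanley_decomposition z Z /\ decomposition_sdepth Z = d).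

End Stanley.

(* The Stanley depth of S/I as an S-module, for I a monomial ideal. *)
Definition sdepth_quot (K : fieldType) (n : nat) (I : ideal {mpoly K[n]}) : nat :=
  sdepth (@quot_component K n I).

(* Neither ideal can be omitted from the intersection of I and J. *)
Definition irredundant (R : comPzRingType) (I J : ideal R) : Prop :=
  ~ {subset I <= J} /\ ~ {subset J <= I}.

(* Main.v *)
Require Import Defs.
From HB Require Import structures.
From mathcomp Require Import all_boot all_order all_algebra.
From mathcomp Require Import mpoly.
From mathcomp Require Import boolp zify.
From mathcomp Require classical_sets.

Set Implicit Arguments.
Unset Strict Implicit.
Unset Printing Implicit Defensive.

Import GRing.Theory.
Local Open Scope nat_scope.

(** The residue ring modulo an intersection of two monomial ideals has the
    monomials outside both as a basis, and a Stanley space in it is spanned by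
    a cone of such monomials: a monomial times all the monomials in a set [Z]
    of variables.  So the Stanley depth is the largest [d] for which these
    basis monomials can be partitioned into finitely many cones of dimension
    at least [d] ([cone_of_stanley], [stanley_of_cone], [sdepth_quotE]).

    Let [A] and [B] be the sets of variables of [Q] and [Q'], with exponents
    [a] and [b].  The Krull dimensions are the numbers of variables outside
    [A], outside [B] and outside [A :|: B] ([krull_dim_quot]).  The upper
    bound on the length of a chain of primes comes from algebraic dependence:
    a family of polynomials with more members than variables satisfies a
    nontrivial relation, and reading it from its lexicographically smallest
    monomial shows that the family cannot climb a chain of primes one step at
    a time ([algebraic_dependence], [dependent_chain]).

    Lower bound ([cone_partition_exists]).  The monomials outside [Q'] split
    into cones in the directions [~: B].  Among the remaining ones, which are
    outside [Q], the exponents of the variables in [A] take finitely many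
    values; the other variables run through all of [~: A], or through the
    ideal generated by the powers [b i] of the variables [i \in B :\: A].
    That ideal is cut into cones by the set of [i] at which the exponent
    reaches [b i]: it is a nonempty subset of [B :\: A], and an interval
    [[X, Y]] of such subsets gives cones in the directions [Y] together with
    the variables outside [A :|: B].  It remains to partition the nonempty
    subsets of a set with [d] elements into intervals whose tops have at least
    [d / 2] elements ([exists_interval_partition]).  For odd [d], place the
    elements on a cycle; for each nonempty [S] there is exactly one [T] such
    that [x \in T] iff [x \in S] or the predecessor of [x] is not in [T].  The
    sets [S] with a given [T] form the interval from the set of elements of [T]
    whose predecessor is in [T] up to [T], and [T] has at least half of the
    elements because of any two neighbours it contains one.

    Upper bound ([cone_partition_bound]).  A monomial that is maximal outside
    [Q] in the directions of [A] and lies in [Q'] is in no cone with a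
    direction in [A]; this gives the bound by the dimension of each residue
    ring.  For the other bound take a monomial [u] outside both ideals that
    every variable of the symmetric difference of [A] and [B] pushes into
    exactly one of them.  The directions of its cone avoid [A :\: B] or
    [B :\: A], say the former.  Then the multiples of [u] by the variables in
    [A :\: B] lie in distinct cones, which are directed in [~: B], and no two
    of these cones point towards each other; so on average they have at most
    [(#|A :\: B| + 1) / 2] directions in [A :\: B] ([cone_half_bound]). *)

Lemma card_setC_ord n (D : {set 'I_n}) : #|~: D| = n - #|D|.
Proof. by rewrite cardsCs setCK card_ord. Qed.

Lemma card_compl_setU n (A B : {set 'I_n}) :
  n - #|A| = n - #|A :|: B| + #|B :\: A|.
Proof.
rewrite -!card_setC_ord -(cardsID B (~: A)) addnC; congr (_ + _).
  by apply: eq_card => i; rewrite !inE negb_or andbC.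
by apply: eq_card => i; rewrite !inE andbC.
Qed.

Lemma uphalf_addC t d : uphalf (t + d + t) = t + uphalf d.
Proof. by lia. Qed.

(** * Partitions of the nonempty subsets of a finite set into intervals *)

(** The partition is given by the functions sending a set to the bottom and to
    the top of its interval: constancy on intervals expresses disjointness. *)
Definition interval_partition (V : finType) (D : {set V})
    (lo hi : {set V} -> {set V}) : Prop :=
  forall S : {set V}, S != set0 -> S \subset D ->
    [/\ lo S != set0, lo S \subset S, S \subset hi S, hi S \subset D
      & forall S' : {set V}, lo S \subset S' -> S' \subset hi S ->
          lo S' = lo S /\ hi S' = hi S].

(** Subtraction of [inZp 1] makes sense in the additive group of ['I_p.+1] for
    every [p], including the trivial group. *)
Definition cyc_pred p (x : 'I_p.+1) : 'I_p.+1 := (x - inZp 1)%R.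

Definition cyclic_top p (S T : {set 'I_p.+1}) : bool :=
  [forall x, (x \in T) == (x \in S) || (cyc_pred x \notin T)].

Lemma cyclic_topP p (S T : {set 'I_p.+1}) :
  reflect (forall x, (x \in T) = (x \in S) || (cyc_pred x \notin T))
    (cyclic_top S T).
Proof. by apply: (iffP forallP) => H x; [apply/eqP|apply/eqP/H]. Qed.

Lemma inZp1Mn p k : (inZp 1 *+ k)%R = inZp k :> 'I_p.+1.
Proof. by apply: val_inj; rewrite Zp_mulrn /= modnMml mul1n. Qed.

(** Every point of the cycle is reached from [s] in fewer than [p.+1] steps;
    both the existence and the uniqueness of tops follow this walk. *)
Lemma cyc_walk p (s x : 'I_p.+1) : x = (s + inZp 1 *+ (x - s)%R)%R.
Proof.
by rewrite inZp1Mn valZpK addrC subrK.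
Qed.

(** Membership in [T] is forced at a point of [S] and then propagates along the
    cycle. *)
Lemma cyclic_top_unique p (S T T' : {set 'I_p.+1}) :
  S != set0 -> cyclic_top S T -> cyclic_top S T' -> T = T'.
Proof.
case/set0Pn=> s sS /cyclic_topP TP /cyclic_topP TP'.
apply/setP=> x; rewrite (cyc_walk s x); elim: (nat_of_ord (x - s)%R) => [|k IHk].
  by rewrite mulr0n addr0 TP TP' sS.
by rewrite TP TP' /cyc_pred mulrSr addrA addrK IHk.
Qed.

Lemma cyclic_top_exists p (S : {set 'I_p.+1}) :
  S != set0 -> exists T, cyclic_top S T.
Proof.
case/set0Pn=> s sS.
pose fix t k := if k is k'.+1 then (s + inZp 1 *+ k \in S)%R || ~~ t k' else true.
exists [set x : 'I_p.+1 | t (x - s)%R]; apply/cyclic_topP => x.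
rewrite !inE; have := cyc_walk s x.
case E: ((x - s)%R : nat) => [|k] xE.
  by rewrite /= xE mulr0n addr0 sS.
have kp : k < p.+1 by rewrite (ltn_trans (ltnSn k)) // -E.
have pred_x : cyc_pred x = (s + inZp 1 *+ k)%R.
  by rewrite /cyc_pred {1}xE mulrSr addrA addrK.
have -> : (cyc_pred x - s)%R = k :> nat.
  by rewrite pred_x addrC addKr inZp1Mn /= modn_small.
by rewrite {1}xE.
Qed.

Lemma cyc_pred_inj p : injective (@cyc_pred p).
Proof. exact: addIr. Qed.

(** The bottom of the interval below [T] is [T] intersected with its shift.
    Since [T] and its shift cover the cycle, an empty bottom would make [T]
    exactly half of it; this is where the odd number [p.+1] of points enters. *)
Lemma cyclic_interval_partition p : ~~ odd p ->
  exists lo hi : {set 'I_p.+1} -> {set 'I_p.+1},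
    interval_partition setT lo hi /\
    forall S, S != set0 -> uphalf p.+1 <= #|hi S|.
Proof.
move=> p_even.
pose hi (S : {set 'I_p.+1}) := odflt set0 [pick T | cyclic_top S T].
have hiP S : S != set0 -> cyclic_top S (hi S).
  move=> /cyclic_top_exists[T TP]; rewrite /hi.
  by case: pickP => [//|/(_ T)]; rewrite TP.
pose lo S : {set 'I_p.+1} := [set x in hi S | cyc_pred x \in hi S].
pose shift S : {set 'I_p.+1} := [set x | cyc_pred x \in hi S].
have card_shift S : #|shift S| = #|hi S|.
  rewrite -[LHS](card_imset _ (@cyc_pred_inj p)); apply: eq_card => y.
  apply/imsetP/idP => [[x]|yS]; first by rewrite inE => ? ->.
  by exists (y + inZp 1)%R; rewrite ?inE /cyc_pred addrK.
have cover_hi S : S != set0 -> hi S :|: shift S = setT.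
  move=> /hiP /cyclic_topP hS; apply/setP => x; rewrite !inE hS.
  by case: (_ \in S) => //=; case: (_ \in hi S).
have cardU S : S != set0 -> #|hi S :|: shift S| = p.+1.
  by move=> S0; rewrite cover_hi // cardsT card_ord.
exists lo, hi; split=> [S S0 _|S S0]; last first.
  have : p.+1 <= #|hi S| + #|shift S|.
    by rewrite -[X in X <= _](cardU S S0) leq_card_setU.
  by rewrite card_shift addnn leq_uphalf_double.
have /cyclic_topP hS := hiP _ S0.
have sub_hi : S \subset hi S by apply/subsetP => x xS; rewrite hS xS.
have loS0 : lo S != set0.
  apply/negP=> /eqP lo0; move: p_even; rewrite -[odd p]negbK -/(odd p.+1).
  have <- : #|hi S| + #|shift S| = p.+1.
    rewrite -cardsUI cardU //.
    suff -> : hi S :&: shift S = set0 by rewrite cards0 addn0.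
    by rewrite -lo0; apply/setP=> x; rewrite !inE.
  by rewrite card_shift addnn odd_double.
split=> //.
  apply/subsetP=> x; rewrite !inE => /andP[]; rewrite hS.
  by case: (_ \in S) => //= /negPf ->.
move=> S' loS' S'hi.
have S'0 : S' != set0 by apply: contraNneq loS0 => S'0; rewrite -subset0 -S'0.
suff hi_eq : hi S' = hi S by split=> //; rewrite /lo hi_eq.
apply: (cyclic_top_unique S'0 (hiP _ S'0)); apply/cyclic_topP=> x.
apply/idP/orP=> [xhi|[/(subsetP S'hi)//|x'hi]]; last by rewrite hS x'hi orbT.
case: (boolP (cyc_pred x \in hi S)) => [x'hi|]; last by right.
by left; apply: (subsetP loS'); rewrite inE xhi.
Qed.

Lemma interval_partition_imset (V W : finType) (f : V -> W)
    (lo hi : {set V} -> {set V}) :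
  injective f -> interval_partition setT lo hi ->
  interval_partition (f @: setT) (fun S => f @: lo (f @^-1: S))
                                 (fun S => f @: hi (f @^-1: S)).
Proof.
move=> f_inj part S S0 SD.
have pre_img (X : {set V}) : f @^-1: (f @: X) = X.
  by apply/setP=> x; rewrite inE mem_imset.
have img_pre (X : {set W}) : X \subset f @: setT -> f @: (f @^-1: X) = X.
  move=> XD; apply/setP=> y; apply/imsetP/idP => [[x]|yX].
    by rewrite inE => ? ->.
  by have /imsetP[x _ yx] := subsetP XD _ yX; exists x; rewrite // inE -yx.
have pre0 : f @^-1: S != set0.
  by apply: contraNneq S0 => S0; rewrite -(img_pre S) // S0 imset0.
have [lo0 loS Shi _ stable] := part _ pre0 (subsetT _).
split.
- by apply: contraNneq lo0 => lo0; rewrite -(pre_img (lo _)) lo0 preimset0.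
- by rewrite -{2}(img_pre S SD) imsetS.
- by rewrite -{1}(img_pre S SD) imsetS.
- by rewrite imsetS ?subsetT.
move=> S' loS' S'hi.
have [] := stable (f @^-1: S').
- by rewrite -{1}(pre_img (lo _)) preimsetS.
- by rewrite -(pre_img (hi _)) preimsetS.
by move=> -> ->.
Qed.

Lemma odd_interval_partition (V : finType) (D : {set V}) : odd #|D| ->
  exists lo hi, interval_partition D lo hi /\
    forall S : {set V}, S != set0 -> S \subset D -> uphalf #|D| <= #|hi S|.
Proof.
case cardD: #|D| => [//|p] /= p_even.
pose f (i : 'I_p.+1) := enum_val (cast_ord (esym cardD) i).
have f_inj : injective f by move=> i j /enum_val_inj /cast_ord_inj.
have fT : f @: setT = D.
  apply/eqP; rewrite eqEcard card_imset // cardsT card_ord cardD leqnn andbT.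
  by apply/subsetP=> _ /imsetP[i _ ->]; exact: enum_valP.
have [lo [hi [part big]]] := cyclic_interval_partition p_even.
have := interval_partition_imset f_inj part; rewrite fT => partD.
do 2!eexists; split; first exact: partD.
move=> S S0 SD; rewrite card_imset // big //.
have [lo0 _ _ _ _] := partD _ S0 SD.
apply: contraNneq S0 => preS0.
rewrite -subset0; apply/subsetP=> y yS.
have := subsetP SD _ yS; rewrite -fT => /imsetP[x _ yx].
have : x \in f @^-1: S by rewrite inE -yx.
by rewrite preS0 inE.
Qed.

(** When [D] has an even number of elements, the sets containing one chosen
    element form a single interval with top [D], and what is left has odd
    size. *)
Lemma exists_interval_partition (V : finType) (D : {set V}) :
  exists lo hi, interval_partition D lo hi /\
    forall S : {set V}, S != set0 -> S \subset D -> uphalf #|D| <= #|hi S|.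
Proof.
case: (boolP (odd #|D|)) => [/odd_interval_partition//|even_D].
have [->|/set0Pn[q qD]] := eqVneq D set0.
  exists id, id; split=> [S S0|S S0]; rewrite subset0 => /eqP S_eq;
  by rewrite S_eq eqxx in S0.
have cardD : #|D| = #|D :\ q|.+1 by rewrite (cardsD1 q) qD.
have [] := @odd_interval_partition _ (D :\ q).
  by move: even_D; rewrite cardD /= negbK.
move=> lo [hi [part big]].
exists (fun S : {set V} => if q \in S then [set q] else lo S).
exists (fun S : {set V} => if q \in S then D else hi S).
have sub_Dq (S : {set V}) : q \notin S -> S \subset D -> S \subset D :\ q.
  by move=> qS SD; rewrite subsetD1 SD qS.
split=> S S0 SD; case: ifPn => qS; last 2 first.
- by rewrite uphalf_half; lia.
- have := big _ S0 (sub_Dq _ qS SD); rewrite cardD.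
  by move: even_D; rewrite cardD; lia.
- split=> //; first by apply/set0Pn; exists q; rewrite inE.
    by rewrite sub1set.
  by move=> S'; rewrite sub1set => ->.
have [lo0 loS Shi hiD stable] := part _ S0 (sub_Dq _ qS SD).
split=> //; first exact: subset_trans hiD (subsetDl _ _).
move=> S' loS' S'hi; have -> : (q \in S') = false; last exact: stable.
by apply/negP=> /(subsetP S'hi)/(subsetP hiD); rewrite !inE eqxx.
Qed.

(** * Cones of monomials and cone partitions *)

Section Cones.
Variable n : nat.
Implicit Types (m u v : 'X_{1..n}) (Z : {set 'I_n}).

Definition in_cone m Z u : bool :=
  [forall i, if i \in Z then (m i <= u i)%N else u i == m i].

Lemma in_coneP m Z u :
  reflect (forall i, (m i <= u i)%N /\ (i \notin Z -> u i = m i)) (in_cone m Z u).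
Proof.
apply: (iffP forallP) => H i; have := H i.
  by case: (i \in Z) => [->|/eqP->].
by case=> le eq; case: ifPn => [_|/eq/eqP].
Qed.

Lemma in_cone_lep m Z u : in_cone m Z u -> (m <= u)%MM.
Proof. by move/in_coneP=> mu; apply/mnm_lepP=> i; have [] := mu i. Qed.

Lemma in_cone_refl m Z : in_cone m Z m.
Proof. by apply/in_coneP. Qed.

Lemma in_cone_add m Z v : (forall i, i \notin Z -> v i = 0%N) -> in_cone m Z (v + m).
Proof.
move=> vZ; apply/in_coneP=> i; rewrite mnmDE leq_addl.
by split=> // /vZ ->.
Qed.

Lemma in_cone_sub m Z u :
  in_cone m Z u -> forall i, i \notin Z -> (u - m)%MM i = 0%N.
Proof. by move/in_coneP=> mu i iZ; rewrite mnmBE (mu i).2 // subnn. Qed.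

Lemma in_cone_trans (M : 'X_{1..n}) (Y : {set 'I_n}) u v :
  in_cone M Y u -> in_cone u Y v -> in_cone M Y v.
Proof.
move=> /in_coneP Mu /in_coneP uv; apply/in_coneP=> i.
have [Mu1 Mu2] := Mu i; have [uv1 uv2] := uv i.
by split=> [|iY]; [exact: leq_trans uv1|rewrite uv2 // Mu2].
Qed.

Lemma in_cone_addU u (Y : {set 'I_n}) i e : i \in Y -> in_cone u Y (u + U_(i) *+ e).
Proof.
move=> iY; rewrite addmC; apply: in_cone_add => l lY.
by rewrite mulmnE mnm1E; case: eqVneq lY => [<-|]; rewrite ?iY ?mul0n.
Qed.

Definition cone_partition (N : pred 'X_{1..n}) (J : Type)
    (m : J -> 'X_{1..n}) (Z : J -> {set 'I_n}) : Prop :=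
  (forall j u, in_cone (m j) (Z j) u -> N u) /\
  (forall u, N u -> exists! j, in_cone (m j) (Z j) u).

End Cones.

Lemma eq_cone_partition n (N N' : pred 'X_{1..n}) J (m : J -> 'X_{1..n}) Z :
  N =1 N' -> cone_partition N m Z -> cone_partition N' m Z.
Proof.
move=> eqN [subN cover]; split=> [j u uj|u Nu]; first by rewrite -eqN (subN j).
by apply: cover; rewrite eqN.
Qed.

(** Cone partitions are built from two functions of a monomial: the set [dir] of
    directions of its cone, and the set [lo] of directions in which the cone
    starts at exponent [b i]; in the other directions it starts at [0]. *)
Section Cells.
Variables (n : nat) (N : pred 'X_{1..n}) (b c : 'I_n -> nat).
Variables (dir lo : 'X_{1..n} -> {set 'I_n}).
Implicit Types (u v : 'X_{1..n}).
Hypothesis lo_dir : forall u, N u -> lo u \subset dir u.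
Hypothesis lo_ge : forall u i, N u -> i \in lo u -> b i <= u i.
Hypothesis dir_bound : forall u i, N u -> i \notin dir u -> u i <= c i.
Hypothesis cell_stable : forall u v, N u ->
  (forall i, i \notin dir u -> v i = u i) ->
  (forall i, i \in lo u -> b i <= v i) -> [/\ N v, dir v = dir u & lo v = lo u].

Definition cell_base u : 'X_{1..n} :=
  [multinom if i \in dir u then (if i \in lo u then b i else 0) else u i | i < n].

Lemma in_cell_base u v : N u -> in_cone (cell_base u) (dir u) v ->
  [/\ N v, dir v = dir u & cell_base v = cell_base u].
Proof.
move=> Nu /in_coneP uv.
have v_dir i : i \notin dir u -> v i = u i.
  by move=> iu; rewrite (uv i).2 // mnmE ifN.
have [|Nv dir_v lo_v] := cell_stable Nu v_dir.
  move=> i ilo; have := (uv i).1.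
  by rewrite mnmE (subsetP (lo_dir Nu)) // ilo.
split=> //; apply/mnmP=> i; rewrite !mnmE dir_v lo_v.
by case: ifPn => // /v_dir.
Qed.

Lemma cell_cone u : N u -> in_cone (cell_base u) (dir u) u.
Proof.
move=> Nu; apply/in_coneP=> i; rewrite mnmE; case: ifPn => // iu; split=> //.
by case: ifP => // /(lo_ge Nu).
Qed.

(** The cones are indexed by their base points, the fixed points of
    [cell_base]; the bound on the exponents outside [dir] leaves finitely many
    of them. *)
Lemma cone_partition_of_cells : exists r (m : 'I_r -> 'X_{1..n}) Z,
  cone_partition N m Z /\ forall j, exists2 u, N u & Z j = dir u.
Proof.
pose D := (\sum_i maxn (b i) (c i)).+1.
have base_lt u : N u -> mdeg (cell_base u) < D.
  move=> Nu; rewrite ltnS mdegE leq_sum // => i _; rewrite mnmE.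
  case: ifPn => [_|/(dir_bound Nu) uc]; last by rewrite leq_max uc orbT.
  by case: ifP; rewrite ?leq_maxl.
have baseP u : N u -> [/\ N (cell_base u), dir (cell_base u) = dir u &
    cell_base (cell_base u) = cell_base u].
  by move=> Nu; apply: in_cell_base => //; exact: in_cone_refl.
pose B := [set x : 'X_{1..n < D} | N x && (cell_base x == x)].
have BP (j : 'I_#|B|) : N (enum_val j : 'X_{1..n < D}) /\
    cell_base (enum_val j : 'X_{1..n < D}) = (enum_val j : 'X_{1..n < D}).
  by have := enum_valP j; rewrite inE => /andP[? /eqP].
exists #|B|, (fun j => bmnm (enum_val j)), (fun j => dir (bmnm (enum_val j))).
split=> [|j]; last by exists (bmnm (enum_val j)); have [] := BP j.
split=> [j u|u Nu].
  by have [Nx xE] := BP j; rewrite -{1}xE => /(in_cell_base Nx)[].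
have [Nbu dir_bu bbu] := baseP u Nu.
have xB : BMultinom (base_lt u Nu) \in B by rewrite inE /= Nbu bbu eqxx.
exists (enum_rank_in xB (BMultinom (base_lt u Nu))).
split; first by rewrite enum_rankK_in //= dir_bu cell_cone.
move=> j; have [Nx xE] := BP j; rewrite -{1}xE => /(in_cell_base Nx)[_ _ uE].
apply: enum_val_inj; rewrite enum_rankK_in //; apply: val_inj => /=.
by rewrite uE xE.
Qed.

End Cells.

(** * Construction of a cone partition *)

Section IrreducibleCells.
Variable n : nat.
Implicit Types (A B D : {set 'I_n}) (a b : 'I_n -> nat) (u v : 'X_{1..n}).

(** The monomials outside the ideal generated by the powers [a i] of the
    variables [i \in A]. *)
Definition below A a u : bool := [forall i in A, u i < a i].

Lemma belowP A a u : reflect (forall i, i \in A -> u i < a i) (below A a u).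
Proof. exact: forall_inP. Qed.

Lemma belowPn A a u : reflect (exists2 i, i \in A & a i <= u i) (~~ below A a u).
Proof.
by apply: (iffP forall_inPn) => -[i iA ui]; exists i; rewrite // -?leqNgt // leqNgt.
Qed.

Lemma eq_below A a u v :
  (forall i, i \in A -> v i = u i) -> below A a v = below A a u.
Proof. by move=> uv; apply: eq_forallb_in => i /uv ->. Qed.

(** [L u] collects the generators of the second ideal that divide [u].  Where it
    is empty the cones have directions [~: B]; where it meets [A] they have
    directions [~: A], because the exponents in [A] decide membership; elsewhere
    [L u] is a nonempty subset of [B :\: A] and its interval decides. *)
Lemma cone_partition_exists A a B b :
  exists r (m : 'I_r -> 'X_{1..n}) Z,
    cone_partition (fun u => below A a u || below B b u) m Z /\
    forall j, minn (n - #|B|) (uphalf ((n - #|A|) + (n - #|A :|: B|))) <= #|Z j|.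
Proof.
have [lo0 [hi0 [part big]]] := exists_interval_partition (B :\: A).
pose L u := [set i in B | b i <= u i].
pose dir u := if below B b u then ~: B else
  if L u :&: A != set0 then ~: A else hi0 (L u) :|: ~: (A :|: B).
pose lo u := if below B b u then set0 else
  if L u :&: A != set0 then set0 else lo0 (L u).
pose N u := below A a u || below B b u.
have L0 u : ~~ below B b u -> L u != set0.
  by move=> /belowPn[i iB ui]; apply/set0Pn; exists i; rewrite inE iB.
have LD u : L u :&: A == set0 -> L u \subset B :\: A.
  rewrite setI_eq0 => LA; rewrite subsetD LA andbT.
  by apply/subsetP=> i; rewrite inE => /andP[].
have [||||r [m [Z [partZ dirZ]]]] := @cone_partition_of_cells n N b
  (fun i => maxn (a i) (b i)) dir lo.
- move=> u _; rewrite /lo /dir; case: ifPn => [|uB]; first by rewrite sub0set.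
  case: ifPn => [|/negPn/LD uD]; first by rewrite sub0set.
  have [_ loL Lhi _ _] := part _ (L0 u uB) uD.
  by apply: subset_trans (subsetUl _ _); exact: subset_trans Lhi.
- move=> u i _; rewrite /lo; case: ifPn => [|uB]; first by rewrite inE.
  case: ifPn => [|/negPn/LD uD]; first by rewrite inE.
  have [_ loL _ _ _] := part _ (L0 u uB) uD.
  by move/(subsetP loL); rewrite inE => /andP[].
- move=> u i Nu iu; rewrite leq_max; apply/orP; move: iu; rewrite /dir.
  case: ifPn => [/belowP uB|uB].
    by rewrite inE negbK => /uB/ltnW; right.
  have /belowP uA : below A a u by move: Nu; rewrite /N (negPf uB) orbF.
  case: ifPn => [_|/negPn/LD uD].
    by rewrite inE negbK => /uA/ltnW; left.
  have [_ _ Lhi _ _] := part _ (L0 u uB) uD.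
  rewrite !inE negb_or negbK => /andP[ihi /orP[/uA/ltnW|iB]]; [by left|right].
  apply: contraR ihi; rewrite -ltnNge => /ltnW biu.
  by apply: (subsetP Lhi); rewrite inE iB.
- move=> u v Nu; rewrite /dir /lo /N; have [uB uv _|uB] := boolP (below B b u).
    have vB : below B b v.
      by rewrite (eq_below b (u := u)) // => i iB; rewrite uv // inE negbK.
    by rewrite vB orbT.
  have uA : below A a u by move: Nu; rewrite /N (negPf uB) orbF.
  have LA : (forall i, i \in A -> v i = u i) -> L v :&: A = L u :&: A.
    move=> uv; apply/setP=> i; rewrite !inE.
    by have [iA|] := boolP (i \in A); [rewrite uv|rewrite !andbF].
  have [uLA uv _|/negPn uLA uv lo_v] := boolP (L u :&: A != set0).
    have uvA i : i \in A -> v i = u i by move=> iA; rewrite uv // inE negbK.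
    have vB : ~~ below B b v.
      move: (uLA); rewrite -(LA uvA) => /set0Pn[i]; rewrite !inE.
      by case/andP=> /andP[iB bi] _; apply/belowPn; exists i.
    by rewrite (negPf vB) (LA uvA) uLA (eq_below a uvA) uA.
  have uD := LD u uLA; have [lo0u loL Lhi hiD stable] := part _ (L0 u uB) uD.
  have uvA i : i \in A -> v i = u i.
    move=> iA; apply: uv; rewrite !inE negb_or negbK iA andbT.
    by apply: contraTN iA => /(subsetP hiD); rewrite inE => /andP[].
  have lo_Lv : lo0 (L u) \subset L v.
    apply/subsetP=> i ilo; rewrite inE lo_v // andbT.
    by have := subsetP loL _ ilo; rewrite inE => /andP[].
  have Lv_hi : L v \subset hi0 (L u).
    apply/subsetP=> i iv; apply: contraTT (iv) => ihi.
    have iB : i \in B by move: iv; rewrite inE => /andP[].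
    have vi : v i = u i by apply: uv; rewrite !inE (negPf ihi) iB orbT.
    move: iv; rewrite !inE vi => iL; apply/negP=> _.
    by case/negP: ihi; apply: (subsetP Lhi); rewrite inE.
  have vB : ~~ below B b v.
    case/set0Pn: lo0u => i /(subsetP lo_Lv); rewrite inE => /andP[iB bi].
    by apply/belowPn; exists i.
  have [lo_eq hi_eq] := stable _ lo_Lv Lv_hi.
  by rewrite (negPf vB) (LA uvA) (eqP uLA) eqxx /= lo_eq hi_eq (eq_below a uvA) uA.
exists r, m, Z; split=> // j; have [u Nu ->] := dirZ j.
have cardAB := card_compl_setU A B.
rewrite geq_min cardAB uphalf_addC; apply/orP; rewrite /dir; case: ifPn => [_|uB].
  by left; rewrite card_setC_ord.
right; case: ifPn => [_|/negPn uLA].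
  by rewrite card_setC_ord cardAB leq_add2l leq_uphalf_double -addnn leq_addr.
have uD := LD u uLA; have [_ _ _ hiD _] := part _ (L0 u uB) uD.
have := big _ (L0 u uB) uD; set X := hi0 (L u) in hiD *.
have -> : #|X :|: ~: (A :|: B)| = #|X| + (n - #|A :|: B|).
  rewrite cardsU card_setC_ord (_ : X :&: _ = set0) ?cards0 ?subn0 //.
  apply/setP=> i; rewrite !inE; apply/negP=> /andP[/(subsetP hiD)].
  by rewrite !inE => /andP[_ ->]; rewrite orbT.
by rewrite addnC leq_add2r.
Qed.
End IrreducibleCells.

(** * Upper bound for cone partitions *)

(** At most one of [l \in R i] and [i \in R l] holds for distinct [i] and [l],
    so [R] has at most [#|E| * #|E|.+1 / 2] pairs on [E], and some point has at
    most the average number of successors. *)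
Lemma antisymmetric_degree_bound (V : finType) (E : {set V}) (R : V -> {set V}) h :
  (forall i, i \in E -> h <= #|R i :&: E|) ->
  (forall i l, i \in E -> l \in E -> i != l -> l \in R i -> i \notin R l) ->
  E != set0 -> h <= uphalf #|E|.
Proof.
move=> big anti E0.
have E_gt0 : 0 < #|E| by rewrite card_gt0.
pose T := \sum_(i in E) #|R i :&: E|.
have leT : #|E| * h <= T by rewrite -sum_nat_const; apply: leq_sum.
have TE : T = \sum_(i in E) \sum_(l in E) (l \in R i).
  apply: eq_bigr => i _; rewrite -sum1_card [RHS]big_mkcond [LHS]big_mkcond /=.
  by apply: eq_bigr => l _; rewrite inE; do 2!case: (l \in _).
have : T + T <= #|E| * #|E| + #|E|.
  rewrite {2}TE exchange_big TE -big_split /=.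
  rewrite -[X in _ <= _ + X]sum1_card -sum_nat_const -big_split /=.
  apply: leq_sum => i iE; rewrite -big_split /= -sum1_card.
  rewrite [X in _ <= X + 1](bigD1 i) //= (bigD1 i) //=.
  rewrite [X in _ <= X]addnAC leq_add //; first by case: (i \in R i).
  apply: leq_sum => l /andP[lE li]; case: (boolP (l \in R i)) => [lR|_]; last first.
    by case: (_ \in _).
  by rewrite (negPf (anti i l iE lE _ lR)) // eq_sym.
move=> TT; suff : h + h <= #|E|.+1 by lia.
by rewrite -(leq_pmul2l E_gt0) mulnDr mulnS; lia.
Qed.

Section UpperBound.
Variable n : nat.
Variables (A B : {set 'I_n}) (a b : 'I_n -> nat).
Variables (J : Type) (m : J -> 'X_{1..n}) (Z : J -> {set 'I_n}) (k : nat).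
Hypothesis a_gt0 : forall i, i \in A -> 0 < a i.
Hypothesis b_gt0 : forall i, i \in B -> 0 < b i.
Hypothesis partZ : cone_partition (fun u => below A a u || below B b u) m Z.
Hypothesis leqZ : forall j, k <= #|Z j|.
Implicit Types (u v : 'X_{1..n}).
Local Notation N := (fun u : 'X_{1..n} => below A a u || below B b u).

Lemma cone_index_uniq j j' u :
  in_cone (m j) (Z j) u -> in_cone (m j') (Z j') u -> j = j'.
Proof.
move=> uj uj'; have [subN cover] := partZ.
have [l [_ l_uniq]] := cover u (subN _ _ uj).
by rewrite -(l_uniq _ uj) -(l_uniq _ uj').
Qed.

(** The monomial [u] is maximal outside the first ideal in the directions of [A],
    and [l] witnesses that it lies in the second one, so no cone through it has
    a direction in [A]. *)
Lemma cone_dim_bound (l : 'I_n) :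
  l \in B -> (l \notin A) || (b l < a l) -> k <= n - #|A|.
Proof.
move=> lB lA; have [subN cover] := partZ.
(* Off A the exponent b i makes u divisible by the generator of the second
   ideal at l. *)
pose u := [multinom if i \in A then (a i).-1 else b i | i < n].
have uA : below A a u.
  by apply/belowP=> i iA; rewrite mnmE iA prednK // a_gt0.
have ul : b l <= u l by rewrite mnmE; case: ifP lA => [lA|//] /=; lia.
have [|j [uj _]] := cover u; first by rewrite uA.
rewrite -card_setC_ord; apply: leq_trans (leqZ j) (subset_leq_card _).
apply/subsetP=> i iZ.
rewrite inE; apply/negP=> iA.
have := subN j (u + U_(i) *+ 1)%MM.
rewrite (in_cone_trans uj) ?in_cone_addU // => /(_ isT) /orP[/belowP/(_ i iA)|].
  by rewrite mnmDE mulmnE mnm1E eqxx mnmE iA addn1 prednK ?ltnn // a_gt0.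
by move/belowP/(_ l lB); rewrite ltnNge mnmDE (leq_trans ul) // leq_addr.
Qed.

(** For [i] in [A :\: B] let [c i] be the cone of [u] times the variable [i].  It
    starts beyond [u] in the direction [i], since otherwise it would be the cone
    of [u], which has no direction in [A :\: B].  It has no direction in [B]
    either: a multiple of [u] by the variable [i] is in the first ideal, and a
    large power of a variable in [B] would put it into the second.  If [c i] had
    direction [l] and [c l] direction [i], both would contain [u] times both
    variables and thus coincide, although [c l] does not start beyond [u] in the
    direction [i]. *)
Lemma cone_half_bound u j :
  (forall i, i \in A :&: B -> u i = (minn (a i) (b i)).-1) ->
  (forall i, i \in A :\: B -> u i = (a i).-1) ->
  (forall i, i \in B :\: A -> u i = (b i).-1) ->
  in_cone (m j) (Z j) u -> [disjoint Z j & A :\: B] -> A :\: B != set0 ->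
  k <= n - #|A :|: B| + uphalf #|A :\: B|.
Proof.
move=> uAB uA uB uj Zj E0; set E := A :\: B in uA Zj E0 *.
have [subN cover] := partZ.
have EA i : i \in E -> i \in A by rewrite inE => /andP[].
have EB i : i \in E -> i \notin B by rewrite inE => /andP[].
have Nu' i : i \in E -> N (u + U_(i) *+ 1)%MM.
  move=> iE; apply/orP; right; apply/belowP=> l lB.
  rewrite mnmDE mulmnE mnm1E; case: eqVneq => [il|_].
    by move: lB; rewrite -il (negPf (EB i iE)).
  have b0 := b_gt0 lB; have [lA|lA] := boolP (l \in A).
    by rewrite uAB ?inE ?lA //; have := a_gt0 lA; lia.
  by rewrite uB ?inE ?lA ?lB //; lia.
have /choice[c cP] (i : 'I_n) : exists j',
    i \in E -> in_cone (m j') (Z j') (u + U_(i) *+ 1)%MM.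
  case: (boolP (i \in E)) => [iE|_]; last by exists j.
  by have [j' [uj' _]] := cover _ (Nu' i iE); exists j'.
have m_gt i : i \in E -> u i < m (c i) i.
  move=> iE; rewrite ltnNge; apply/negP=> le_mu.
  have /in_coneP ci := cP i iE.
  have iZ : i \in Z (c i).
    apply: contraT => /(ci i).2; rewrite mnmDE mulmnE mnm1E eqxx /=.
    by move: le_mu; lia.
  have uci : in_cone (m (c i)) (Z (c i)) u.
    apply/in_coneP=> l; have [ci1 ci2] := ci l.
    move: ci1 ci2; rewrite mnmDE mulmnE mnm1E.
    case: eqVneq => [<-|_]; first by rewrite iZ.
    by rewrite mul0n addn0.
  have jc := cone_index_uniq uj uci.
  by have := disjointFr Zj (x := i); rewrite jc iZ iE => /(_ isT).
have ZB i : i \in E -> Z (c i) \subset ~: B.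
  move=> iE; apply/subsetP=> l lZ; rewrite inE; apply/negP=> lB.
  have := subN (c i) (u + U_(i) *+ 1 + U_(l) *+ b l)%MM.
  rewrite (in_cone_trans (cP i iE)) ?in_cone_addU //.
  move=> /(_ isT) /orP[/belowP|/belowP].
    move=> /(_ i (EA i iE)); rewrite !mnmDE !mulmnE !mnm1E eqxx uA //.
    by have := a_gt0 (EA i iE); lia.
  by move=> /(_ l lB); rewrite !mnmDE !mulmnE !mnm1E eqxx; lia.
rewrite -leq_subLR.
apply: (@antisymmetric_degree_bound _ E (fun i => Z (c i))) => //
  [i iE|i l iE lE il li].
  rewrite leq_subLR -card_setC_ord addnC; apply: leq_trans (leqZ (c i)) _.
  apply: leq_trans (leq_card_setU _ _); apply/subset_leq_card/subsetP=> l lZ.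
  have := subsetP (ZB i iE) _ lZ; rewrite /E !inE lZ => /negPf ->.
  by rewrite orbF /= orbN.
apply/negP=> il'.
have comm : (u + U_(i) *+ 1 + U_(l) *+ 1 = u + U_(l) *+ 1 + U_(i) *+ 1)%MM.
  by rewrite -!addmA [(_ *+ 1 + _)%MM in LHS]addmC.
have cil : c i = c l.
  apply: (@cone_index_uniq _ _ (u + U_(i) *+ 1 + U_(l) *+ 1)%MM).
    by rewrite (in_cone_trans (cP i iE)) ?in_cone_addU.
  by rewrite comm (in_cone_trans (cP l lE)) ?in_cone_addU.
have := m_gt i iE; rewrite ltnNge cil => /negP; apply.
have /in_coneP/(_ i)[+ _] := cP l lE.
by rewrite mnmDE mulmnE mnm1E eq_sym (negPf il) mul0n addn0.
Qed.

End UpperBound.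

(** The arithmetic of the bound: [q], [q'] and [t] are the three dimensions, [d]
    and [d'] the numbers of variables in [B :\: A] and in [A :\: B]. *)
Lemma leq_max_min_half k q q' t d d' :
  k <= q -> k <= q' -> q = t + d -> q' = t + d' ->
  [\/ d' = 0, d = 0, k <= t + uphalf d' | k <= t + uphalf d] ->
  k <= maxn (minn q' (uphalf (q + t))) (minn q (uphalf (q' + t))).
Proof.
by move=> kq kq' qE q'E [d0|d0|kd|kd]; subst; lia.
Qed.

(** The two existence hypotheses say that neither of the ideals generated by the
    powers [a i], [i \in A], and [b i], [i \in B], contains the other. *)
Lemma cone_partition_bound n (A B : {set 'I_n}) (a b : 'I_n -> nat) J
    (m : J -> 'X_{1..n}) (Z : J -> {set 'I_n}) k :
  (forall i, i \in A -> 0 < a i) -> (forall i, i \in B -> 0 < b i) ->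
  (exists2 l, l \in A & (l \notin B) || (a l < b l)) ->
  (exists2 l, l \in B & (l \notin A) || (b l < a l)) ->
  cone_partition (fun u => below A a u || below B b u) m Z ->
  (forall j, k <= #|Z j|) ->
  k <= maxn (minn (n - #|B|) (uphalf ((n - #|A|) + (n - #|A :|: B|))))
            (minn (n - #|A|) (uphalf ((n - #|B|) + (n - #|A :|: B|)))).
Proof.
move=> a_gt0 b_gt0 [l' l'A l'P] [l lB lP] part leqZ.
have part' : cone_partition (fun u => below B b u || below A a u) m Z.
  by apply: eq_cone_partition part => u; rewrite orbC.
have leA := cone_dim_bound a_gt0 part leqZ lB lP.
have leB := cone_dim_bound b_gt0 part' leqZ l'A l'P.
have cardA := card_compl_setU A B; have := card_compl_setU B A.
rewrite setUC => cardB.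
apply: (leq_max_min_half leA leB cardA cardB).
have [->|AB0] := eqVneq (A :\: B) set0; first by rewrite cards0; constructor 1.
have [->|BA0] := eqVneq (B :\: A) set0; first by rewrite cards0; constructor 2.
(* The exponents of u are the largest below both bounds, so that one more factor
   in the symmetric difference of A and B leads into exactly one ideal. *)
pose u := [multinom if i \in A then
    (if i \in B then (minn (a i) (b i)).-1 else (a i).-1) else (b i).-1 | i < n].
have uAB i : i \in A :&: B -> u i = (minn (a i) (b i)).-1.
  by rewrite inE mnmE => /andP[-> ->].
have uA i : i \in A :\: B -> u i = (a i).-1.
  by rewrite inE mnmE => /andP[/negPf -> ->].
have uB i : i \in B :\: A -> u i = (b i).-1.
  by rewrite inE mnmE => /andP[/negPf -> _].
have [subN cover] := part.
have [|j [uj _]] := cover u.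
  apply/orP; left; apply/belowP=> i iA; rewrite mnmE iA.
  have ai := a_gt0 i iA; case: ifP => [/b_gt0 bi|_]; lia.
have [dj|] := boolP [disjoint Z j & A :\: B].
  by constructor 3; exact: cone_half_bound uAB uA uB uj dj AB0.
have [dj _|] := boolP [disjoint Z j & B :\: A].
  constructor 4; rewrite setUC.
  apply: (cone_half_bound _ _ part' _ _ uB uA uj) => //.
  by move=> i; rewrite setIC minnC; exact: uAB.
(* A cone of u with directions x in A and y in B would contain u times both
   variables, which lies in both ideals. *)
move=> /pred0Pn[y /andP[/= yZ yBA]] /pred0Pn[x /andP[/= xZ xAB]].
have := subN j (u + U_(x) *+ 1 + U_(y) *+ 1)%MM.
rewrite (in_cone_trans (in_cone_trans uj (in_cone_addU u 1 xZ))) ?in_cone_addU //.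
move: (uA x xAB) (uB y yBA) => ux uy /(_ isT).
move: xAB yBA; rewrite !inE => /andP[_ xA] /andP[_ yB].
case/orP => /belowP; [move/(_ x xA)|move/(_ y yB)].
  by rewrite !mnmDE !mulmnE !mnm1E eqxx ux; have := a_gt0 x xA; lia.
by rewrite !mnmDE !mulmnE !mnm1E eqxx uy; have := b_gt0 y yB; lia.
Qed.

Local Open Scope ring_scope.

(** * Prime chains of a residue ring *)

Lemma greatest_eq (E : nat -> Prop) d :
  E d -> (forall e, E e -> (e <= d)%N) -> greatest E = d.
Proof.
move=> Ed max_d; apply: classical_sets.xget_unique; first by split.
by move=> e [Ee max_e]; apply/eqP; rewrite eqn_leq max_d // max_e.
Qed.

Section PrimeChains.
Variables (R : comPzRingType) (I : ideal R).

Lemma prime_ideal_exp (P : ideal R) (x : R) k :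
  prime_ideal P -> x ^+ k \in P -> x \in P.
Proof.
move=> [P1 PM]; elim: k => [|k IHk]; first by rewrite expr0 (negPf P1).
by rewrite exprS => /PM[].
Qed.

Definition quot_preim_mem (J : ideal (quot_ring I)) : {pred R} :=
  fun f => quot_pi I f \in J.

Lemma quot_pi0 : quot_pi I 0 = 0.
Proof. by apply: (addrI (quot_pi I 0)); rewrite -quot_piD !addr0. Qed.

Lemma quot_preim0 J : 0 \in quot_preim_mem J.
Proof. by rewrite unfold_in quot_pi0 ideal0. Qed.

Lemma quot_preim_lin J (a : R) :
  {in quot_preim_mem J &, forall u v, a * u + v \in quot_preim_mem J}.
Proof.
move=> u v; rewrite !unfold_in => uJ vJ.
by rewrite quot_piD quot_piM; exact: (ideal_lin (quot_pi I a)).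
Qed.

Definition quot_preim J : ideal R := Ideal (quot_preim0 J) (@quot_preim_lin J).

Lemma mem_quot_preim J f : (f \in quot_preim J) = (quot_pi I f \in J).
Proof. by []. Qed.

Lemma quot_preim_sub J : {subset I <= quot_preim J}.
Proof.
move=> f fI; rewrite mem_quot_preim.
suff -> : quot_pi I f = 0 by exact: ideal0.
by rewrite -quot_pi0; apply/quot_piP; rewrite subr0.
Qed.

Lemma prime_quot_preim J : prime_ideal J -> prime_ideal (quot_preim J).
Proof.
move=> [J1 JM]; split=> [|a b]; first by rewrite mem_quot_preim.
by rewrite !mem_quot_preim quot_piM => /JM.
Qed.

Lemma chain_quot_preim d (P : nat -> ideal (quot_ring I)) :
  prime_chain d P -> prime_chain d (fun i => quot_preim (P i)).
Proof.
move=> [primeP incP]; split=> i ltid; first exact/prime_quot_preim/primeP.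
have [sub nsub] := incP i ltid; split=> [f|sub']; first exact: sub.
apply: nsub => z; rewrite -[z]quot_reprK; exact: sub'.
Qed.

(** The image under the projection, rather than the preimage under the choice of
    representatives, because it is an ideal for every [J]. *)
Definition quot_image_mem (J : ideal R) : {pred quot_ring I} :=
  fun z => `[< exists2 f, f \in J & z = quot_pi I f >].

Lemma quot_image0 J : 0 \in quot_image_mem J.
Proof. by apply/asboolP; exists 0; rewrite ?quot_pi0 ?ideal0. Qed.

Lemma quot_image_lin J (a : quot_ring I) :
  {in quot_image_mem J &, forall u v, a * u + v \in quot_image_mem J}.
Proof.
move=> u v /asboolP[f fJ ->] /asboolP[g gJ ->]; apply/asboolP.
exists (quot_repr a * f + g); first exact: ideal_lin.
by rewrite quot_piD quot_piM quot_reprK.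
Qed.

Definition quot_image J : ideal (quot_ring I) :=
  Ideal (quot_image0 J) (@quot_image_lin J).

Lemma mem_quot_image (J : ideal R) f : {subset I <= J} ->
  (quot_pi I f \in quot_image J) = (f \in J).
Proof.
move=> subIJ; apply/asboolP/idP => [[g gJ /quot_piP /subIJ fgJ]|fJ].
  by rewrite -(subrK g f) rpredD.
by exists f.
Qed.

Lemma prime_quot_image (J : ideal R) :
  {subset I <= J} -> prime_ideal J -> prime_ideal (quot_image J).
Proof.
move=> subIJ [J1 JM]; split=> [|a b]; first by rewrite mem_quot_image.
rewrite -[a]quot_reprK -[b]quot_reprK.
have -> : quot_pi I (quot_repr a) * quot_pi I (quot_repr b) =
  quot_pi I (quot_repr a * quot_repr b) by rewrite quot_piM.
by rewrite !mem_quot_image // => /JM.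
Qed.

Lemma chain_quot_image d (P : nat -> ideal R) :
  (forall i, (i <= d)%N -> {subset I <= P i}) ->
  prime_chain d P -> prime_chain d (fun i => quot_image (P i)).
Proof.
move=> subIP [primeP incP]; split=> i ltid.
  by apply: prime_quot_image; [exact: subIP|exact: primeP].
have [sub nsub] := incP i ltid; split=> [z|sub'].
  have subi := subIP i (ltnW ltid); have subSi := subIP i.+1 ltid.
  by rewrite -[z]quot_reprK !mem_quot_image //; exact: sub.
apply: nsub => f fP; rewrite -mem_quot_image; last exact/subIP/ltnW.
by apply: sub'; rewrite mem_quot_image //; exact: subIP.
Qed.

End PrimeChains.

(** * Algebraic dependence *)

Section Subpoly.
Variables (K : fieldType) (n : nat).
Local Notation S := {mpoly K[n]}.
Implicit Types (f g : S) (Z : {set 'I_n}).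

Lemma subpolyX Z (m : 'X_{1..n}) :
  (forall i, i \notin Z -> m i = 0%N) -> subpoly Z ('X_[m] : S).
Proof. by move=> mZ u; rewrite msuppX inE => /eqP ->. Qed.

Lemma subpolyZ Z c f : subpoly Z f -> subpoly Z (c *: f).
Proof. by move=> fZ m /msuppZ_le; exact: fZ. Qed.

Lemma subpolyB Z f g : subpoly Z f -> subpoly Z g -> subpoly Z (f - g).
Proof. by move=> fZ gZ m /msuppB_le; rewrite mem_cat => /orP[/fZ|/gZ]. Qed.

Lemma subpoly0 Z : subpoly Z (0 : S).
Proof. by move=> m; rewrite msupp0. Qed.

Lemma subpoly1 Z : subpoly Z (1 : S).
Proof. by rewrite -mpolyX0; apply: subpolyX => i _; rewrite mnm0E. Qed.

Lemma subpolyM Z f g : subpoly Z f -> subpoly Z g -> subpoly Z (f * g).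
Proof.
move=> fZ gZ m /msuppM_le /allpairsP[[u v] /= [uf vg ->]] i iZ.
by rewrite mnmDE (fZ _ uf) // (gZ _ vg).
Qed.

End Subpoly.

Section AlgebraicDependence.
Variables (K : fieldType) (n : nat) (W : {set 'I_n}).
Local Notation S := {mpoly K[n]}.

Definition bounded_over (D : nat) (f : S) : Prop :=
  subpoly W f /\ forall m, m \in msupp f -> (mdeg m <= D)%N.

Lemma bounded_over1 : bounded_over 0 1.
Proof.
by split=> [|m]; [exact: subpoly1|rewrite msupp1 inE => /eqP->; rewrite mdeg0].
Qed.

Lemma bounded_overM D E f g :
  bounded_over D f -> bounded_over E g -> bounded_over (D + E) (f * g).
Proof.
move=> [Wf Df] [Wg Eg]; split; first exact: subpolyM.
move=> m /msuppM_le /allpairsP[[u v] /= [uf vg ->]].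
by rewrite mdegD leq_add ?Df ?Eg.
Qed.

Lemma bounded_over_prod d (F : 'I_d -> S) (D : 'I_d -> nat) :
  (forall j, bounded_over (D j) (F j)) ->
  bounded_over (\sum_j D j) (\prod_j F j).
Proof.
move=> FD; elim/big_rec2: _ => [|j E g _ gE]; first exact: bounded_over1.
exact: bounded_overM.
Qed.

Lemma bounded_overX D f k : bounded_over D f -> bounded_over (k * D) (f ^+ k).
Proof.
move=> fD; elim: k => [|k IHk]; first exact: bounded_over1.
by rewrite exprS mulSn; exact: bounded_overM.
Qed.

Lemma exists_bound d (f : 'I_d -> S) : (forall j, subpoly W (f j)) ->
  exists D, forall j, bounded_over D (f j).
Proof.
move=> Wf; exists (\max_j msize (f j))%N => j; split=> // m mf.
by rewrite (leq_trans _ (leq_bigmax j)) // ltnW // msize_mdeg_lt.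
Qed.

Lemma row_dependent r c (A : 'M[K]_(r, c)) : (c < r)%N ->
  exists2 v : 'rV_r, v != 0 & v *m A = 0.
Proof.
move=> ltcr; have /rowV0Pn[v /sub_kermxP vA v0] : kermx A != 0.
  rewrite kermx_eq0 /row_free neq_ltn.
  by rewrite (leq_ltn_trans (rank_leq_col A) ltcr).
by exists v.
Qed.

(** With exponents below [N], the [N ^ d] power products of the [f j] lie in the
    span of the monomials in the variables of [W] with exponents at most
    [d * (N * D)], whose number is of order [N ^ #|W|].  For [N] large there are
    more products than monomials, and the coefficients of a linear relation
    between the products are those of [p]. *)
Lemma algebraic_dependence d (f : 'I_d -> S) :
  (#|W| < d)%N -> (forall j, subpoly W (f j)) ->
  exists2 p : {mpoly K[d]}, p != 0 & p \mPo [tuple f j | j < d] = 0.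
Proof.
move=> ltWd Wf; have [D fD] := exists_bound Wf.
(* This N exceeds (d * D).+1 ^ #|W|, so that M ^ #|W| < N * N ^ #|W|. *)
pose N := ((d * D).+1 ^ #|W|).+1; pose M := (d * (N * D)).+1.
have ltMN : (M ^ #|W| < N ^ d)%N.
  have leM : (M <= N * (d * D).+1)%N by rewrite /M; nia.
  have leMk k : (M ^ k <= (N * (d * D).+1) ^ k)%N.
    by elim: k => // k IHk; rewrite !expnS leq_mul.
  rewrite (leq_ltn_trans (leMk _)) //.
  rewrite expnMn (@leq_trans (N ^ #|W| * N)) ?ltn_pmul2l ?expn_gt0 //.
  by rewrite -expnSr leq_pexp2l.
pose X := {ffun 'I_d -> 'I_N}.
pose Y := [set g : {ffun 'I_n -> 'I_M} | [forall i, (i \notin W) ==> (g i == ord0)]].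
have cardX : #|X| = (N ^ d)%N by rewrite card_ffun !card_ord.
have cardY : #|Y| = (M ^ #|W|)%N.
  rewrite -[in RHS](card_ord M) -(card_pffun_on (ord0 : 'I_M) (mem W) predT).
  apply: eq_card => g; rewrite inE; apply/forallP/pffun_onP.
    move=> gW; split=> //.
    apply/subsetP=> i; rewrite inE; apply: contraNT => iW.
    by have := gW i; rewrite iW.
  move=> [/subsetP gW _] i; apply/implyP; apply: contraNT.
  by move=> gi; apply: gW; rewrite inE.
pose mon (k : 'I_#|X|) : 'X_{1..d} :=
  [multinom nat_of_ord ((enum_val k : X) j) | j < d].
pose col (l : 'I_#|Y|) : 'X_{1..n} := [multinom nat_of_ord (enum_val l i) | i < n].
pose A := \matrix_(k, l) (\prod_j f j ^+ mon k j)@_(col l).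
have [|v v0 vA] := @row_dependent _ _ A; first by rewrite cardX cardY.
have mon_inj : injective mon.
  move=> k l /mnmP eq_kl; apply: enum_val_inj; apply/ffunP => j.
  by apply: val_inj; have := eq_kl j; rewrite !mnmE.
exists (\sum_k v 0 k *: 'X_[mon k]).
  have [k vk] : exists k, v 0 k != 0 by apply/rV0Pn.
  apply: contraNneq vk => /(congr1 (mcoeff (mon k))).
  rewrite mcoeff0 raddf_sum (bigD1 k) //= mcoeffZ mcoeffX eqxx mulr1.
  rewrite big1 ?addr0 => [->//|l lk].
  by rewrite mcoeffZ mcoeffX (inj_eq mon_inj) (negPf lk) mulr0.
rewrite raddf_sum /=; apply/mpolyP => m; rewrite mcoeff0 raddf_sum /=.
under eq_bigr do rewrite comp_mpolyZ comp_mpolyX mcoeffZ.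
have bnd k : bounded_over (d * (N * D)) (\prod_j f j ^+ mon k j).
  have [Wp Dp] := bounded_over_prod (fun j => bounded_overX (mon k j) (fD j)).
  split=> // u /Dp /leq_trans -> //.
  rewrite -[X in (_ <= X * _)%N](card_ord d) -sum_nat_const leq_sum // => j _.
  by rewrite leq_mul2r mnmE (ltnW (ltn_ord _)) orbT.
under eq_bigr do under eq_bigr do rewrite tnth_mktuple.
case: (pselect (exists l, m = col l)) => [[l ->]|not_col].
  transitivity ((v *m A) 0 l); last by rewrite vA mxE.
  by rewrite mxE; apply: eq_bigr => k _; rewrite mxE.
apply: big1 => k _; rewrite memN_msupp_eq0 ?mulr0 //; apply/negP=> mp.
have [/(_ m mp) mW /(_ m mp) mD] := bnd k; apply: not_col.
pose g := [ffun i => inord (m i) : 'I_M].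
have mM i : (m i <= d * (N * D))%N.
  by rewrite (leq_trans _ mD) // mdegE (bigD1 i) //= leq_addr.
have gY : g \in Y.
  rewrite inE; apply/forallP=> i; apply/implyP=> /mW mi.
  by rewrite ffunE mi; apply/eqP/val_inj; rewrite /= inordK.
exists (enum_rank_in gY g); apply/mnmP=> i.
by rewrite mnmE enum_rankK_in // ffunE inordK ?ltnS.
Qed.
End AlgebraicDependence.

(** * Primes generated by variables *)

Section VariablePrimes.
Variables (K : fieldType) (n : nat).
Local Notation S := {mpoly K[n]}.
Implicit Types (W : {set 'I_n}) (J : ideal S).

Lemma ideal_msupp J (f : S) : (forall m, m \in msupp f -> 'X_[m] \in J) -> f \in J.
Proof.
move=> fJ; rewrite [f]mpolyE big_seq rpred_sum // => m /fJ mJ.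
by rewrite -mul_mpolyC idealMl.
Qed.

Definition kill W : n.-tuple S := [tuple if i \in W then 0 else 'X_i | i < n].

Definition avoids W (m : 'X_{1..n}) : bool := [forall i in W, m i == 0%N].

Lemma kill_mpolyX W m : 'X_[m] \mPo kill W = if avoids W m then 'X_[m] else 0.
Proof.
rewrite comp_mpolyX; case: ifPn => [/forall_inP mW|/forall_inPn[i iW mi]].
  rewrite [RHS]mpolyXE_id; apply: eq_bigr => i _; rewrite tnth_mktuple.
  by case: ifPn => // /mW /eqP ->; rewrite !expr0.
by rewrite (bigD1 i) //= tnth_mktuple iW expr0n (negPf mi) mul0r.
Qed.

Lemma mcoeff_kill W (f : S) m : (f \mPo kill W)@_m = f@_m *+ avoids W m.
Proof.
rewrite comp_mpolyEX raddf_sum /=.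
have termE u : (f@_u *: ('X_[u] \mPo kill W))@_m =
    if u == m then f@_m *+ avoids W m else 0.
  rewrite mcoeffZ kill_mpolyX; case: (eqVneq u m) => [->|um].
    by case: ifP; rewrite ?mcoeffX ?eqxx ?mcoeff0 ?mulr1 ?mulr0.
  by case: ifP; rewrite ?mcoeffX ?(negPf um) ?mcoeff0 mulr0.
under eq_bigr do rewrite termE.
case: (boolP (m \in msupp f)) => mf.
  rewrite (bigD1_seq m) ?msupp_uniq //= eqxx big1 ?addr0 // => u.
  by move/negPf=> ->.
rewrite (memN_msupp_eq0 mf) mul0rn big1_seq // => u /andP[_ uf].
by case: eqP => // um; rewrite um (negPf mf) in uf.
Qed.

(** The prime generated by the variables in [W], as the kernel of the
    substitution [kill W]: primality is then the absence of zero divisors. *)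
Definition var_prime_mem W : {pred S} := fun f => f \mPo kill W == 0.

Lemma var_prime0 W : 0 \in var_prime_mem W.
Proof. by rewrite unfold_in comp_mpoly0. Qed.

Lemma var_prime_lin W (a : S) :
  {in var_prime_mem W &, forall u v, a * u + v \in var_prime_mem W}.
Proof.
move=> u v; rewrite !unfold_in => /eqP u0 /eqP v0.
by rewrite comp_mpolyD rmorphM /= u0 v0 mulr0 addr0.
Qed.

Definition var_prime W : ideal S := Ideal (var_prime0 W) (@var_prime_lin W).

Lemma prime_var_prime W : prime_ideal (var_prime W).
Proof.
split=> [|a b]; rewrite !unfold_in /var_prime_mem.
  by rewrite comp_mpoly1 oner_eq0.
by rewrite rmorphM mulf_eq0 => /orP.
Qed.

Lemma mem_var_prime W (f : S) :
  f \in var_prime W <-> forall m, m \in msupp f -> ~~ avoids W m.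
Proof.
split=> [/eqP f0 m|f_meets].
  rewrite mcoeff_msupp; apply: contra => mW.
  by have := mcoeff_kill W f m; rewrite f0 mcoeff0 mW mulr1n => <-.
apply/eqP/mpolyP=> m; rewrite mcoeff_kill mcoeff0.
case: (boolP (m \in msupp f)) => [/f_meets/negPf->//|/memN_msupp_eq0->].
by rewrite mul0rn.
Qed.

Lemma var_prime_sub W W' : W \subset W' -> {subset var_prime W <= var_prime W'}.
Proof.
move=> /subsetP sWW' f /mem_var_prime fW; apply/mem_var_prime=> m /fW.
by apply: contra => /forall_inP mW'; apply/forall_inP => i /sWW'; exact: mW'.
Qed.

Lemma var_primeX W m : ('X_[m] \in var_prime W) = ~~ avoids W m.
Proof.
apply/idP/idP=> [/mem_var_prime|mW]; first by apply; rewrite msuppX inE.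
by apply/mem_var_prime=> u; rewrite msuppX inE => /eqP ->.
Qed.

Lemma var_primeXU W i : ('X_i \in var_prime W) = (i \in W).
Proof.
rewrite var_primeX; apply/forall_inPn/idP => [[j jW]|iW]; last first.
  by exists i; rewrite // mnm1E eqxx.
by rewrite mnm1E eqb0 negbK => /eqP->.
Qed.

(** Modulo an ideal containing the variables in [W], every polynomial is
    congruent to one in the other variables. *)
Lemma kill_sub_mem J W (f : S) :
  (forall i, i \in W -> 'X_i \in J) -> f - (f \mPo kill W) \in J.
Proof.
move=> WJ; apply: ideal_msupp => m; rewrite mcoeff_msupp mcoeffB mcoeff_kill.
case: (boolP (avoids W m)) => [_|/forall_inPn[i iW mi] _].
  by rewrite subrr eqxx.
by rewrite -(@submK _ U_(i) m) ?lep1mP // mpolyXD idealMl // WJ.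
Qed.

Lemma subpoly_kill W (f : S) : subpoly (~: W) (f \mPo kill W).
Proof.
move=> m; rewrite mcoeff_msupp mcoeff_kill => /negPf m0 i; rewrite inE negbK.
move: m0; case: (boolP (avoids W m)) => [/forall_inP mW _ /mW /eqP//|].
by rewrite eqxx.
Qed.
End VariablePrimes.

(** * Dimension of residue rings *)

(** The elements of a family that climbs a chain of primes are algebraically
    independent.  In a relation [p] between them, factor out the smallest power
    of the first variable: the cofactor evaluates into [P 0], because [f 0] is
    not in that prime, and its terms still divisible by the variable evaluate
    into [P 1], because [f 0] is in it.  What remains is a relation modulo [P 1]
    in one variable fewer.  After [d] steps a nonzero constant lies in [P d]. *)
Lemma dependent_chain (K : fieldType) (n d : nat) (P : nat -> ideal {mpoly K[n]})
    (f : 'I_d -> {mpoly K[n]}) (p : {mpoly K[d]}) :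
  prime_chain d P ->
  (forall k : 'I_d, f k \notin P k) -> (forall k : 'I_d, f k \in P k.+1) ->
  p \mPo [tuple f k | k < d] = 0 -> p = 0.
Proof.
move=> [primeP incP] fnP fP p_f; apply/eqP/negPn/negP=> p0.
set F := [tuple f k | k < d] in p_f.
suff /(_ d (leqnn d)) [q [q0 q_const qF]] : forall k : nat, (k <= d)%N ->
    exists q : {mpoly K[d]}, [/\ q != 0,
      forall m, m \in msupp q -> forall j : 'I_d, (j < k)%N -> m j = 0%N &
      q \mPo F \in P k].
  have [Pd1 _] := primeP d (leqnn d).
  have qC : q = (q@_0)%:MP.
    apply/mpolyP=> m; rewrite mcoeffC.
    case: (boolP (m \in msupp q)) => [/q_const m0|mq].
      by have -> : m = 0%MM; [apply/mnmP=> j; rewrite m0 ?mnm0E|rewrite eqxx mulr1].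
    rewrite memN_msupp_eq0 //; case: eqVneq mq => [->|]; rewrite ?mulr0 //.
    by move/memN_msupp_eq0 ->; rewrite mul0r.
  have c0 : q@_0 != 0 by apply: contraNneq q0 => c0; rewrite qC c0 mpolyC0.
  case/negP: Pd1; rewrite -[1]/(1%:MP) -(mulVf c0) mpolyCM.
  by apply: idealMl; move: qF; rewrite qC comp_mpolyC mcoeffC eqxx mulr1.
elim=> [|k IHk] ltkd.
  by exists p; split=> //; rewrite p_f ideal0.
have [q [q0 q_supp qF]] := IHk (ltnW ltkd).
pose i := Ordinal ltkd; have [sub _] := incP k ltkd.
have [_ PkM] := primeP k (ltnW ltkd).
have [m0 m0q min_m0] : exists2 m0, m0 \in msupp q &
    forall m, m \in msupp q -> (m0 i <= m i)%N.
  have [m mq] : exists m, m \in msupp q.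
    by exists (mlead q); exact: mlead_supp.
  have exE : exists e, has (fun m : 'X_{1..d} => m i == e) (msupp q).
    by exists (m i); apply/hasP; exists m.
  case: (ex_minnP exE) => e /hasP[m0 m0q /eqP <-] min_e.
  by exists m0 => // u uq; apply: min_e; apply/hasP; exists u.
pose e := (U_(i) *+ m0 i)%MM.
have e_le m : m \in msupp q -> (e <= m)%MM.
  move=> /min_m0 le; apply/mnm_lepP=> j; rewrite mulmnE mnm1E.
  by case: eqVneq => [<-|]; rewrite ?mul1n ?mul0n.
pose part (B : pred 'X_{1..d}) : {mpoly K[d]} :=
  \sum_(m <- msupp q | B m) q@_m *: 'X_[m - e].
pose r := part (fun m => m i == m0 i); pose s := part (fun m => m i != m0 i).
have qE : q = 'X_[e] * (r + s).
  have <- : \sum_(m <- msupp q) q@_m *: 'X_[m - e] = r + s.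
    by rewrite (bigID (fun m : 'X_{1..d} => m i == m0 i)).
  rewrite mulr_sumr {1}[q]mpolyE big_seq [RHS]big_seq; apply: eq_bigr => m mq.
  by rewrite -scalerAr -mpolyXD addmC submK // e_le.
have Xe_f : 'X_[e] \mPo F = f i ^+ m0 i.
  by rewrite -mpolyXn rmorphXn /= comp_mpolyXU -tnth_nth tnth_mktuple.
have sP : s \mPo F \in P k.+1.
  rewrite raddf_sum /= big_seq_cond; apply: rpred_sum => m /andP[mq mi].
  rewrite comp_mpolyZ -mul_mpolyC; apply: idealMl.
  have -> : (m - e = (m - e - U_(i)) + U_(i))%MM.
    rewrite submK // lep1mP mnmBE mulmnE mnm1E eqxx mul1n.
    by rewrite subn_eq0 -ltnNge ltn_neqAle eq_sym mi min_m0.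
  rewrite mpolyXD rmorphM /= comp_mpolyXU -tnth_nth tnth_mktuple.
  by apply: idealMl; exact: (fP i).
have rsP : (r + s) \mPo F \in P k.+1.
  apply: sub; move: qF; rewrite qE rmorphM /= Xe_f => /PkM[|//].
  by move/(prime_ideal_exp (primeP k (ltnW ltkd))); rewrite (negPf (fnP i)).
have r_coeff m : m \in msupp q -> m i = m0 i -> r@_(m - e) = q@_m.
  move=> mq mi; rewrite raddf_sum /= (big_rem m) //= mi eqxx mcoeffZ mcoeffX eqxx.
  rewrite mulr1 big_seq_cond big1 ?addr0 // => u /andP[u_rem _].
  rewrite mcoeffZ mcoeffX; case: eqP => [ume|_]; last by rewrite mulr0.
  have uq : u \in msupp q by exact: mem_rem u_rem.
  have um : u = m by rewrite -(submK (e_le u uq)) ume submK // e_le.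
  by move: u_rem; rewrite um mem_rem_uniq ?msupp_uniq // !inE eqxx.
exists r; split.
- apply: contraTneq (m0q) => r0; have := r_coeff m0 m0q erefl.
  by rewrite r0 mcoeff0 mcoeff_msupp => <-; rewrite eqxx.
- move=> m mr j ltjk.
  have : m \in flatten [seq msupp (q@_u *: 'X_[u - e])
                       | u : 'X_{1..d} <- msupp q & u i == m0 i].
    by have := msupp_sum_le mr; rewrite /=.
  case/flattenP=> t /mapP[u]; rewrite mem_filter => /andP[/eqP ui uq] ->.
  move=> /msuppZ_le; rewrite msuppX inE => /eqP ->.
  rewrite mnmBE mulmnE mnm1E; case: eqVneq => [<-|ij].
    by rewrite ui mul1n subnn.
  rewrite mul0n subn0 (q_supp u uq) //.
  move: ltjk; rewrite ltnS leq_eqVlt -[k]/(nat_of_ord i) (inj_eq val_inj).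
  by rewrite eq_sym (negPf ij).
- by move: rsP; rewrite raddfD /= rpredDr.
Qed.

Section KrullDimension.
Variables (K : fieldType) (n : nat).
Local Notation S := {mpoly K[n]}.
Implicit Types (W : {set 'I_n}) (I J : ideal S).

(** Pick in each step of the chain an element that the step adds, and remove the
    variables of [W] from it: this changes no membership, and a chain that is
    too long yields more elements than there are variables left. *)
Lemma prime_chain_bound W d (P : nat -> ideal S) :
  (forall i, i \in W -> 'X_i \in P 0%N) -> prime_chain d P ->
  (d <= n - #|W|)%N.
Proof.
move=> WP chainP; have [primeP incP] := chainP.
rewrite -card_setC_ord leqNgt; apply/negP=> ltd.
have WPk i k : i \in W -> (k <= d)%N -> 'X_i \in P k.
  move=> iW; elim: k => [|k IHk] ltk; first exact: WP.
  by have [sub _] := incP k ltk; apply: sub; apply: IHk; exact: ltnW.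
have /choice[g gP] (k : 'I_d) : exists g : S, g \notin P k /\ g \in P k.+1.
  have [_ nsub] := incP k (ltn_ord k).
  apply: contrapT => none; apply: nsub => g gP.
  by apply/negPn/negP=> gnP; apply: none; exists g.
pose f k := g k \mPo kill K W.
have gf k i : (i <= d)%N -> (f k \in P i) = (g k \in P i).
  move=> lei; have gfP : g k - f k \in P i.
    by apply: kill_sub_mem => j jW; exact: WPk.
  by rewrite -[g k in RHS](subrK (f k)) rpredDl.
have [p p0 pf] := algebraic_dependence ltd (fun k => @subpoly_kill K n W (g k)).
case/negP: p0; apply/eqP; apply: (dependent_chain chainP _ _ pf) => k.
  by rewrite (gf k k) ?(ltnW (ltn_ord k)) //; have [] := gP k.
by rewrite (gf k k.+1) ?ltn_ord //; have [] := gP k.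
Qed.

Definition flag W k : {set 'I_n} := W :|: [set i in take k (enum (~: W))].

Lemma flag_chain W : prime_chain (n - #|W|) (fun k => var_prime K (flag W k)).
Proof.
have cardW : size (enum (~: W)) = (n - #|W|)%N.
  by rewrite -cardE card_setC_ord.
split=> [i _|k ltk]; first exact: prime_var_prime.
split.
  apply: var_prime_sub; rewrite setUS //; apply/subsetP=> i; rewrite !inE.
  by rewrite -(take_takel _ (leqnSn k)); exact: mem_take.
have ltk' : (k < size (enum (~: W)))%N by rewrite cardW.
have [i0 _] : exists i : 'I_n, true.
  by case: (enum (~: W)) ltk' => [|i s] //; exists i.
pose i := nth i0 (enum (~: W)) k.
have iW : i \notin W by have := mem_nth i0 ltk'; rewrite mem_enum inE.
move=> /(_ 'X_i); rewrite !var_primeXU !inE (negPf iW) /=.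
rewrite (take_nth i0) // mem_rcons inE eqxx => /(_ isT).
move=> /(nthP i0)[j]; rewrite size_takel ?(ltnW ltk') // => ltjk.
rewrite nth_take // => /eqP; rewrite nth_uniq ?enum_uniq ?(ltn_trans ltjk) //.
by rewrite ltn_eqF.
Qed.

(** The hypotheses say that the radical of [I] is generated by the variables in
    [W]. *)
Lemma krull_dim_quot I W :
  (forall i, i \in W -> exists k, 'X_i ^+ k \in I) ->
  {subset I <= var_prime K W} -> krull_dim (quot_ring I) = (n - #|W|)%N.
Proof.
move=> powI subI; apply: greatest_eq => [|d [P chainP]].
  exists (fun k => quot_image I (var_prime K (flag W k))).
  apply: chain_quot_image (flag_chain W) => k _ f /subI; apply: var_prime_sub.
  exact: subsetUl.
have chainP' := chain_quot_preim chainP; apply: (prime_chain_bound _ chainP').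
move=> i /powI[k Xk]; have [prime0 _] := chainP'.
by apply: (prime_ideal_exp (prime0 0%N (leq0n d))); exact: quot_preim_sub Xk.
Qed.
End KrullDimension.

(** * Stanley decompositions and cone partitions *)

Section StanleyCones.
Variables (K : fieldType) (n : nat) (I : ideal {mpoly K[n]}) (N : pred 'X_{1..n}).
Local Notation S := {mpoly K[n]}.
(* I is a monomial ideal, and N is the set of monomials outside it. *)
Hypothesis memI : forall f : S, f \in I <-> forall m, m \in msupp f -> ~~ N m.
Implicit Types (f g : S) (m u : 'X_{1..n}) (Z : {set 'I_n}).

Lemma memN_mcoeff f u : f \in I -> N u -> f@_u = 0.
Proof.
move=> /memI fI Nu; apply/eqP; rewrite mcoeff_eq0; apply: contraL Nu; exact: fI.
Qed.

Lemma quot_pi_eq0 f : quot_pi I f = 0 <-> f \in I.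
Proof. by rewrite -(quot_pi0 I) quot_piP subr0. Qed.

Lemma quot_scalepi f g : f *: (quot_pi I g : quot_ring I) = quot_pi I (f * g).
Proof. by rewrite quot_piM. Qed.

Lemma quot_pi_sum (J : finType) (F : J -> S) :
  quot_pi I (\sum_j F j) = \sum_j (quot_pi I (F j) : quot_ring I).
Proof.
apply: (big_morph (quot_pi I)) => [f g|]; [exact: quot_piD|exact: quot_pi0].
Qed.

Lemma mcoeff_cone g m Z u : subpoly Z g ->
  (g * 'X_[m])@_u = if in_cone m Z u then g@_(u - m) else 0.
Proof.
move=> gZ; case: ifPn => [/in_cone_lep/submK um|unotin].
  by rewrite -{1}um addmC mcoeffMX.
apply: memN_msupp_eq0; apply: contra unotin.
rewrite (perm_mem (msuppMX _ _)) => /mapP[v vg ->].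
by rewrite addmC in_cone_add //; exact: gZ.
Qed.

(** A homogeneous element is a scalar multiple of a monomial.  If a monomial of
    the cone were in [I], multiplication by some monomial of [K[Z]] would
    annihilate [z], and with it all the coordinates of [z] in a basis. *)
Lemma stanley_space_cone (z : quot_ring I) Z :
  stanley_space (@quot_component K n I) z Z ->
  exists c m, [/\ c != 0, z = quot_pi I (c *: 'X_[m]) &
    forall u, in_cone m Z u -> N u].
Proof.
case=> [[a [f af zE]] z0 [k [b [bP b_free]]]].
have f0 : f != 0.
  by apply: contra_neq z0 => f0; rewrite zE f0; apply/quot_pi_eq0; exact: ideal0.
have m_supp := mlead_supp f0; set m := mlead f in m_supp.
have fE : f = f@_m *: 'X_[m].
  apply/mpolyP=> u; rewrite mcoeffZ mcoeffX.
  case: eqVneq => [<-|mu]; rewrite ?mulr1 ?mulr0 //; apply: memN_msupp_eq0.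
  apply: contra mu => uf; apply/eqP/mnmP=> i.
  by apply/eqP; rewrite -eqz_nat (af _ uf) (af _ m_supp).
exists f@_m, m; split; [by rewrite -mcoeff_msupp|by rewrite -fE|].
move=> u um; apply/negPn/negP=> Nu.
have /bP[c cZ zc] : cyclic_space z Z z.
  by exists 1; [exact: subpoly1|rewrite scale1r].
have umZ : subpoly Z ('X_[u - m] : S) by apply: subpolyX; exact: in_cone_sub um.
have : 'X_[u - m] *: z = 0.
  rewrite zE quot_scalepi; apply/quot_pi_eq0; rewrite fE -scalerAr -mpolyXD.
  rewrite submK ?(in_cone_lep um) //; apply/memI=> v /msuppZ_le.
  by rewrite msuppX inE => /eqP ->.
rewrite {1}zc scaler_sumr; under eq_bigr do rewrite scalerA.
move=> /(b_free _ (fun j => subpolyM umZ (cZ j))) c0.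
case/negP: z0; rewrite zc big1 // => j _.
have /eqP := c0 j; rewrite mulf_eq0 => /orP[|/eqP->]; last by rewrite scale0r.
by rewrite -msupp_eq0 msuppX.
Qed.

(** A basis monomial occurs in one of the summands of its own decomposition, so
    it lies in a cone.  If it lay in two cones, placing it in either summand
    would give two decompositions. *)
Lemma cone_of_stanley r (z : 'I_r -> quot_ring I) (Z : 'I_r -> {set 'I_n}) :
  stanley_decomposition (@quot_component K n I) z Z ->
  exists m : 'I_r -> 'X_{1..n}, cone_partition N m Z.
Proof.
move=> [spaces decomp].
have /choice[cm cmP] j : exists cm : K * 'X_{1..n}, [/\ cm.1 != 0,
    z j = quot_pi I (cm.1 *: 'X_[cm.2]) & forall u, in_cone cm.2 (Z j) u -> N u].
  by have [c [m ?]] := stanley_space_cone (spaces j); exists (c, m).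
exists (fun j => (cm j).2); split=> [j|u Nu]; first by have [] := cmP j.
have [y [[yZ y_sum] y_uniq]] := decomp (quot_pi I 'X_[u]).
have /choice[g gP] j : exists g, subpoly (Z j) g /\ y j = g *: z j.
  by have [g] := yZ j; exists g.
have [j uj] : exists j, in_cone (cm j).2 (Z j) u.
  apply: contrapT => not_in.
  have : 'X_[u] - \sum_j g j * ((cm j).1 *: 'X_[(cm j).2]) \in I.
    apply/quot_piP; rewrite y_sum quot_pi_sum; apply: eq_bigr => j _.
    by have [_ ->] := gP j; have [_ -> _] := cmP j; rewrite quot_scalepi.
  move=> /memN_mcoeff/(_ Nu)/eqP; rewrite mcoeffB mcoeffX eqxx raddf_sum /=.
  rewrite big1 ?subr0 ?oner_eq0 // => j _.
  rewrite -scalerAr mcoeffZ (mcoeff_cone _ _ (gP j).1) ifN ?mulr0 //.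
  by apply/negP=> uj; apply: not_in; exists j.
exists j; split=> // j' uj'; apply/eqP/negPn/negP=> jj'.
pose at_cone i : {ffun 'I_r -> quot_ring I} :=
  [ffun k => if k == i then quot_pi I 'X_[u] else 0].
have at_coneP i : in_cone (cm i).2 (Z i) u -> at_cone i = y.
  move=> ui; symmetry; apply: y_uniq; split=> [k|]; last first.
    rewrite (bigD1 i) //= ffunE eqxx big1 ?addr0 // => k /negPf ki.
    by rewrite ffunE ki.
  rewrite ffunE; case: eqVneq => [->|_]; last first.
    by exists 0; [exact: subpoly0|rewrite scale0r].
  have [c0 zE _] := cmP i.
  exists ((cm i).1^-1 *: 'X_[u - (cm i).2]).
    by apply/subpolyZ/subpolyX; exact: in_cone_sub ui.
  rewrite zE quot_scalepi -scalerAl -scalerAr scalerA mulVf // scale1r.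
  by rewrite -mpolyXD submK // (in_cone_lep ui).
have at_eq := etrans (at_coneP _ uj) (esym (at_coneP _ uj')).
have := congr1 (fun h : {ffun _} => h j) at_eq.
rewrite !ffunE eqxx (negPf jj') => /quot_pi_eq0 /memI /(_ u).
by rewrite msuppX inE eqxx Nu => /(_ isT).
Qed.

(** The component of a residue class at a cone gathers the terms of a
    representative that lie in the cone.  Terms outside all cones are in [I], and
    since distinct cones share no monomial a sum over the cones is in [I] only
    if all its summands vanish. *)
Lemma stanley_of_cone r (m : 'I_r -> 'X_{1..n}) (Z : 'I_r -> {set 'I_n}) :
  cone_partition N m Z ->
  stanley_decomposition (@quot_component K n I)
    (fun j => quot_pi I 'X_[m j]) Z.
Proof.
move=> [subN cover].
have cone_free j g : subpoly (Z j) g -> g * 'X_[m j] \in I -> g = 0.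
  move=> gZ gI; apply/mpolyP=> u; rewrite mcoeff0.
  case: (boolP (u \in msupp g)) => [ug|/memN_msupp_eq0//].
  have uj : in_cone (m j) (Z j) (u + m j) by apply: in_cone_add; exact: gZ.
  by have := memN_mcoeff gI (subN _ _ uj); rewrite addmC mcoeffMX.
have cone_indep (e : 'I_r -> S) : (forall j, subpoly (Z j) (e j)) ->
    \sum_j e j * 'X_[m j] \in I -> forall j, e j = 0.
  move=> eZ eI j; apply: (cone_free j _ (eZ j)); apply/memI=> u.
  apply: contraTN => Nu; rewrite mcoeff_msupp negbK; apply/eqP.
  have [uj|uj] := boolP (in_cone (m j) (Z j) u); last first.
    by rewrite (mcoeff_cone _ _ (eZ j)) ifN.
  rewrite -(memN_mcoeff eI Nu) raddf_sum (bigD1 j) //= big1 ?addr0 // => k kj.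
  rewrite (mcoeff_cone _ _ (eZ k)) ifN //; apply: contraNN kj => uk.
  have [i [_ i_uniq]] := cover u Nu.
  by rewrite -(i_uniq _ uj) -(i_uniq _ uk).
split=> [j|x].
  split.
  - exists (fun i => (m j i)%:Z), 'X_[m j] => // u.
    by rewrite msuppX inE => /eqP ->.
  - apply/eqP=> /quot_pi_eq0 /memI /(_ (m j)).
    rewrite msuppX inE eqxx => /(_ isT).
    by rewrite (subN j) // in_cone_refl.
  exists 1%N, (fun=> quot_pi I 'X_[m j]); split=> [x|c cZ].
    split=> [[f fZ ->]|[c cZ ->]]; last first.
      by exists (c ord0); rewrite // big_ord1.
    by exists (fun=> f); rewrite // big_ord1.
  rewrite big_ord1 quot_scalepi => /quot_pi_eq0 cI k.
  by rewrite (ord1 k); exact: cone_free cI.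
pose f := quot_repr x; have xE : x = quot_pi I f by rewrite quot_reprK.
pose g j := \sum_(u <- msupp f | in_cone (m j) (Z j) u) f@_u *: 'X_[u - m j].
have gZ j : subpoly (Z j) (g j).
  rewrite /g; elim/big_rec: _ => [|u h uj hZ]; first exact: subpoly0.
  move=> v /msuppD_le; rewrite mem_cat => /orP[|/hZ//].
  by move: v; apply: subpolyZ; apply: subpolyX; exact: in_cone_sub uj.
have g_sum : x = \sum_j (quot_pi I (g j * 'X_[m j]) : quot_ring I).
  rewrite -quot_pi_sum xE; apply/quot_piP.
  have -> : \sum_j g j * 'X_[m j] =
      \sum_(u <- msupp f) \sum_(j | in_cone (m j) (Z j) u) f@_u *: 'X_[u].
    rewrite (exchange_big_dep predT) //=; apply: eq_bigr => j _.
    rewrite mulr_suml; apply: eq_bigr => u /in_cone_lep uj.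
    by rewrite -scalerAl -mpolyXD submK.
  rewrite {1}[f]mpolyE -sumrB; apply: rpred_sum => u _.
  case: (boolP (N u)) => [Nu|nNu].
    have [j [uj uj_uniq]] := cover u Nu.
    rewrite (big_pred1 j) ?subrr ?ideal0 // => k /=.
    by apply/idP/eqP => [/uj_uniq ->|->].
  rewrite big_pred0 ?subr0 => [|j]; last by apply: contraNF nNu; exact: subN.
  by apply/memI=> v /msuppZ_le; rewrite msuppX inE => /eqP->.
exists [ffun j => g j *: quot_pi I 'X_[m j]]; split.
  split=> [j|]; first by exists (g j); rewrite ?ffunE.
  by rewrite g_sum; apply: eq_bigr => j _; rewrite ffunE quot_scalepi.
move=> y [yZ y_sum].
have /choice[h hP] j : exists h, subpoly (Z j) h /\ y j = h *: quot_pi I 'X_[m j].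
  by have [h] := yZ j; exists h.
have hg0 : forall j, g j - h j = 0.
  apply: cone_indep => [j|]; first exact: subpolyB (gZ j) (hP j).1.
  under eq_bigr do rewrite mulrBl.
  rewrite sumrB; apply/quot_piP; rewrite !quot_pi_sum.
  rewrite -g_sum y_sum; apply: eq_bigr => j _; by rewrite (hP j).2 quot_scalepi.
apply/ffunP => j; rewrite ffunE (hP j).2; congr (_ *: _).
by apply/eqP; rewrite -subr_eq0 hg0.
Qed.
End StanleyCones.

(** * Irreducible monomial ideals *)

Section IrreducibleIdeals.
Variables (K : fieldType) (n : nat) (A : {set 'I_n}) (a : 'I_n -> nat).
Local Notation S := {mpoly K[n]}.

(** The ideal generated by the powers [a i] of the variables [i \in A], described
    by its monomials; the minimality of a generated ideal is tested on it. *)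
Definition not_below_mem : {pred S} :=
  fun f => all (fun m => ~~ below A a m) (msupp f).

Lemma not_below0 : 0 \in not_below_mem.
Proof. by rewrite unfold_in /not_below_mem msupp0. Qed.

Lemma not_below_lin (h : S) :
  {in not_below_mem &, forall f g, h * f + g \in not_below_mem}.
Proof.
move=> f g /allP fP /allP gP; apply/allP=> m /msuppD_le.
rewrite mem_cat => /orP[/msuppM_le /allpairsP[[u v] /= [_ vf ->]]|/gP//].
have /belowPn[i iA vi] := fP _ vf.
by apply/belowPn; exists i; rewrite // mnmDE (leq_trans vi) // leq_addl.
Qed.

Definition not_below_ideal : ideal S := Ideal not_below0 not_below_lin.

Variable Q : ideal S.
Hypothesis Q_gen : generates (fun g => exists2 i, i \in A & g = 'X_i ^+ a i) Q.

Lemma mem_irreducible f : f \in Q <-> forall m, m \in msupp f -> ~~ below A a m.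
Proof.
have [genQ minQ] := Q_gen; split=> [fQ|fN].
  apply/allP; apply: (minQ not_below_ideal) fQ => _ [i iA ->].
  apply/allP=> m; rewrite mpolyXn msuppX inE => /eqP ->.
  by apply/belowPn; exists i; rewrite // mulmnE mnm1E eqxx mul1n.
apply: ideal_msupp => m /fN /belowPn[i iA ai].
rewrite -(@submK _ (U_(i) *+ a i) m) ?mpolyXD.
  by apply: idealMl; apply: genQ; exists i; rewrite // mpolyXn.
apply/mnm_lepP=> l; rewrite mulmnE mnm1E.
by case: eqVneq => [<-|]; rewrite ?mul1n ?mul0n.
Qed.

Lemma irreducible_pow i : i \in A -> exists k, 'X_i ^+ k \in Q.
Proof. by move=> iA; exists (a i); apply: Q_gen.1; exists i. Qed.

Lemma irreducible_sub_prime :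
  (forall i, i \in A -> 0 < a i)%N -> {subset Q <= var_prime K A}.
Proof.
move=> a_gt0; apply: Q_gen.2 => _ [i iA ->].
by rewrite -(prednK (a_gt0 i iA)) exprSr idealMl // var_primeXU.
Qed.

End IrreducibleIdeals.

Lemma not_subset_witness (K : fieldType) (n : nat) (A B : {set 'I_n})
    (a b : 'I_n -> nat) (Q Q' : ideal {mpoly K[n]}) :
  generates (fun g => exists2 i, i \in A & g = 'X_i ^+ a i) Q ->
  generates (fun g => exists2 i, i \in B & g = 'X_i ^+ b i) Q' ->
  ~ {subset Q <= Q'} ->
  exists2 l, l \in A & (l \notin B) || (a l < b l)%N.
Proof.
move=> Q_gen Q'_gen nsub; apply: contrapT => none; apply: nsub.
apply: Q_gen.2 => _ [i iA ->]; have /negP := fun h => none (ex_intro2 _ _ i iA h).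
rewrite negb_or negbK -leqNgt => /andP[iB ba].
by rewrite -(subnK ba) exprD idealMl //; apply: Q'_gen.1; exists i.
Qed.

(** * Stanley depth of the intersection *)

Lemma bigmin_leq (I : eqType) (s : seq I) (F : I -> nat) k i :
  i \in s -> (\big[minn/k]_(j <- s) F j <= F i)%N.
Proof.
elim: s => // j s IHs; rewrite inE big_cons => /orP[/eqP->|/IHs].
  exact: geq_minl.
by apply: leq_trans; exact: geq_minr.
Qed.

Lemma leq_bigmin (I : Type) (s : seq I) (F : I -> nat) k l :
  (l <= k)%N -> (forall i, l <= F i)%N -> (l <= \big[minn/k]_(j <- s) F j)%N.
Proof.
move=> lk lF; elim/big_rec: _ => // i x _ lx.
by rewrite leq_min lF.
Qed.

(** The Stanley depth of a monomial residue ring is decided by the monomials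
    outside the ideal alone. *)
Lemma sdepth_quotE (K : fieldType) n (I : ideal {mpoly K[n]})
    (N : pred 'X_{1..n}) d :
  (forall f, f \in I <-> forall m, m \in msupp f -> ~~ N m) -> (d <= n)%N ->
  (exists r (m : 'I_r -> 'X_{1..n}) Z,
     cone_partition N m Z /\ forall j, (d <= #|Z j|)%N) ->
  (forall r (m : 'I_r -> 'X_{1..n}) Z k, cone_partition N m Z ->
     (forall j, k <= #|Z j|)%N -> (k <= d)%N) ->
  sdepth_quot I = d.
Proof.
move=> memI led [r [m [Z [part leqZ]]]] bound.
have le_d r' (z : 'I_r' -> quot_ring I) Z' :
    stanley_decomposition (@quot_component K n I) z Z' ->
    (decomposition_sdepth Z' <= d)%N.
  move=> /(cone_of_stanley memI)[m' part'].
  by apply: (bound _ _ _ _ part') => j; apply: bigmin_leq; exact: mem_index_enum.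
apply: greatest_eq => [|_ [r' [z' [Z' [dec <-]]]]]; last exact: le_d dec.
have dec := stanley_of_cone memI part.
exists r, (fun j => quot_pi I 'X_[m j]), Z; split=> //.
by apply/eqP; rewrite eqn_leq (le_d _ _ _ dec) leq_bigmin.
Qed.

Theorem corollary2p4 (K : fieldType) (n : nat) (Q Q' : ideal {mpoly K[n]})
  (irrQ : irreducible_monomial Q) (irrQ' : irreducible_monomial Q')
  (Q_neq0 : nonzero_ideal Q) (Q'_neq0 : nonzero_ideal Q')
  (Ass_neq : ~ (forall P : ideal {mpoly K[n]},
     associated_prime (quot_ring Q) P <-> associated_prime (quot_ring Q') P))
  (irrdQQ' : irredundant Q Q') :
  let dimQ := krull_dim (quot_ring Q) in
  let dimQ' := krull_dim (quot_ring Q') in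
  let dimQQ' := krull_dim (quot_ring (idealD Q Q')) in
  sdepth_quot (idealI Q Q') =
    maxn (minn dimQ' (uphalf (dimQ + dimQQ')))
         (minn dimQ (uphalf (dimQ' + dimQQ'))).
Proof.
have [A [a [a_gt0 genQ]]] := irrQ; have [B [b [b_gt0 genQ']]] := irrQ'.
have [nQQ' nQ'Q] := irrdQQ'.
move=> dimQ dimQ' dimQQ'.
have dimQE : dimQ = (n - #|A|)%N.
  apply: krull_dim_quot => [i|]; first exact: (irreducible_pow genQ).
  exact: (irreducible_sub_prime genQ a_gt0).
have dimQ'E : dimQ' = (n - #|B|)%N.
  apply: krull_dim_quot => [i|]; first exact: (irreducible_pow genQ').
  exact: (irreducible_sub_prime genQ' b_gt0).
have dimQQ'E : dimQQ' = (n - #|A :|: B|)%N.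
  apply: krull_dim_quot => [i|f /asboolP[g gQ [h hQ' ->]]]; last first.
    rewrite rpredD //.
      apply: (var_prime_sub (subsetUl A B)).
      exact: (irreducible_sub_prime genQ a_gt0).
    apply: (var_prime_sub (subsetUr A B)).
    exact: (irreducible_sub_prime genQ' b_gt0).
  rewrite inE => /orP[/(irreducible_pow genQ)|/(irreducible_pow genQ')] [k Xk].
    exists k; apply/asboolP; exists ('X_i ^+ k) => //.
    by exists 0; rewrite ?ideal0 ?addr0.
  exists k; apply/asboolP; exists 0; rewrite ?ideal0 //.
  by exists ('X_i ^+ k); rewrite ?add0r.
rewrite dimQE dimQ'E dimQQ'E.
apply: (@sdepth_quotE _ _ _ (fun u => below A a u || below B b u)).
- move=> f; split=> [/andP[fQ fQ'] m mf|fN].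
    rewrite negb_or ((mem_irreducible genQ f).1 fQ) //.
    by rewrite ((mem_irreducible genQ' f).1 fQ').
  apply/andP; split.
    by apply/(mem_irreducible genQ) => m /fN; rewrite negb_or => /andP[].
  by apply/(mem_irreducible genQ') => m /fN; rewrite negb_or => /andP[].
- by rewrite geq_max !geq_min !leq_subr.
- case: (leqP (minn _ _) (minn _ _)) => [_|_]; last exact: cone_partition_exists.
  rewrite setUC.
  have [r [m [Z [part leqZ]]]] := cone_partition_exists B b A a.
  by exists r, m, Z; split=> //; apply: eq_cone_partition part => u; rewrite orbC.
move=> r m Z k; apply: cone_partition_bound => //.
  exact: not_subset_witness genQ genQ' nQQ'.
exact: not_subset_witness genQ' genQ nQ'Q.
Qed.
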